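(* Let $T,T'$ be contractions on a complex Hilbert space $\mathcal{H}$. Suppose that $T$ is Harnack dominated by $T'$. Then there is $c>0$ such that for each $h\in\mathcal{H}$ and each $\lambda\in\mathbb{D}$, $$\|(I-\lambda T)^{-1}(T-T')h\|^2\le \frac{c}{1-|\lambda|^2}\,\|D_{T'}h\|^2 .$$ If $T$ is an isometry, the converse is also true: if there is $c>0$ such that $\|(I-\lambda T)^{-1}(T-T')h\|^2\le \frac{c}{1-|\lambda|^2}\,\|D_{T'}h\|^2$ holds for all $\lambda\in\mathbb{D}$ and all $h\in\mathcal{H}$, then $T$ is Harnack dominated by $T'$.
   Context: $\mathbb{D}$ is the open unit disc in $\mathbb{C}$. A contraction on $\mathcal{H}$ is a bounded linear operator of norm at most $1$; for a contraction $T$, $D_T=(I-T^*T)^{1/2}$ is its defect operator. For contractions $T,T'$ on $\mathcal{H}$, $T$ is Harnack dominated by $T'$ if there is a constant $c\ge 1$ such that $\operatorname{Re} p(T)\le c\,\operatorname{Re} p(T')$ for every analytic polynomial $p$ with $\operatorname{Re} p(z)\ge 0$ for all $|z|\le 1$; here $\operatorname{Re} A=\frac12(A+A^* )$ for an operator $A$. *)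

(* Defs.v *)
From HB Require Import structures.
From mathcomp Require Import all_boot all_order all_algebra.
From mathcomp Require Import all_classical all_reals all_analysis.
From mathcomp Require Import complex.

Set Implicit Arguments.
Unset Strict Implicit.
Unset Printing Implicit Defensive.

Import Order.TTheory GRing.Theory Num.Theory.
Import numFieldNormedType.Exports.

Local Open Scope classical_set_scope.
Local Open Scope ring_scope.
Local Open Scope complex_scope.

(* The inner product is linear in its first argument and conjugate-linear in
   its second one. *)
HB.mixin Record CompleteNormedModule_isHilbert (R : realType) H
    & CompleteNormedModule R[i] H := {
  inner : {dot H for @Num.conj R[i]} ;
  inner_normE : forall x : H, inner x x = `|x| ^+ 2
}.

#[short(type="hilbertType")]
HB.structure Definition Hilbert (R : realType) :=
  { H of CompleteNormedModule_isHilbert R H & CompleteNormedModule R[i] H }.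

Notation "''[' x , y ]" := (inner x y) : ring_scope.

Section Operators.
Variables (R : realType) (H : hilbertType R).
Implicit Types (A B S : H -> H) (T : {linear H -> H}).

(* For linear [T], this says that [T] is bounded with operator norm <= 1. *)
Definition contractive T := forall x : H, `|T x| <= `|x|.

Definition isometric T := forall x : H, `|T x| = `|x|.

(* The unique adjoint when [A] is a bounded linear operator; unspecified when
   [A] has no adjoint. *)
Definition adjoint A : H -> H :=
  get [set S : H -> H | forall x y, '[A x, y] = '[x, S y]].

Definition Re_op A : H -> H := fun x => 2^-1 *: (A x + adjoint A x).

(* [0 <= z] in [R[i]] means that [z] is a nonnegative real; since the space is
   complex, a positive operator is thereby self-adjoint. *)
Definition positive_op A := forall x : H, 0 <= '[A x, x].

Definition le_op A B := positive_op (B \- A).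

(* The unique positive square root when [A] is a bounded positive operator;
   unspecified when there is none. *)
Definition sqrt_op A : H -> H :=
  get [set S : H -> H |
    [/\ linear S, continuous S, positive_op S & S \o S = A]].

Definition defect T : H -> H :=
  sqrt_op (fun x => x - adjoint T (T x)).

(* The two-sided inverse when [A] is bijective; unspecified otherwise. *)
Definition inv_op A : H -> H :=
  get [set S : H -> H | cancel A S /\ cancel S A].

Definition poly_op (p : {poly R[i]}) T : H -> H :=
  fun x => \sum_(k < size p) p`_k *: iter k T x.

Definition harnack_dominated T T' :=
  exists c : R, 1 <= c /\
    forall p : {poly R[i]},
      (forall z : R[i], `|z| <= 1 -> 0 <= complex.Re p.[z]) ->
      le_op (Re_op (poly_op p T)) (fun x => c%:C *: Re_op (poly_op p T') x).

End Operators.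

(* Main.v *)
From HB Require Import structures.
Require Import Defs.
From mathcomp Require Import all_boot all_order all_algebra.
From mathcomp Require Import all_classical all_reals all_analysis.
From mathcomp Require Import cyclic separable cyclotomic.
From mathcomp Require Import complex ring lra zify.

Import Order.TTheory GRing.Theory Num.Theory.
Import numFieldNormedType.Exports.

Set Implicit Arguments.
Unset Strict Implicit.
Unset Printing Implicit Defensive.

Local Open Scope ring_scope.
Local Open Scope complex_scope.

(** Both directions compare two positive quadratic forms attached to a
    contraction.  If [V] is the minimal isometric dilation of [T], the Toeplitz
    form of a finite family [h] is [|sum_k V^k h_k|^2].  Writing [g_m] for the
    component in [H] of [sum_k V^k h_(m+k)], it equals
    [|g_0|^2 + sum_(m >= 1) (|g_m|^2 - |T g_m|^2)] ([toeplitz_tails]), and it is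
    this formula, rather than the dilation, that is used below.  The families
    [h] and [g] determine each other, since [h_m = g_m - T g_(m+1)].

    Harnack domination of [T] by [T'] with constant [c] is equivalent to the
    inequality between their Toeplitz forms with the same [c].  The link is the
    Fejer form [fejer T M z], the Fejer kernel of order [M] evaluated at [T].
    Domination gives the inequality between Fejer forms because the Fejer
    kernel has nonnegative real part on the closed disc
    ([fejer_kernel_ge], [harnack_fejer]).  Averaging Fejer forms over the
    [P]-th roots of unity, with the vectors [sum_n w^n h_n], gives
    [M toeplitz - d] with [d] independent of [M], and [M -> oo] yields the
    inequality between Toeplitz forms ([fejer_average],
    [fejer_toeplitz_le]).  Conversely a Fejer form is a Toeplitz form, and
    averaging it with the weights [Re p(w) >= 0] gives
    [M Re <p(T) x, x> - d] ([fejer_poly_average], [fejer_harnack]).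

    For the first implication choose [h] so that the [g] of [T'] is
    [0, x, lambda x, lambda^2 x, ...]: then the Toeplitz form of [T'] is
    [sum_k |lambda|^(2k) (|x|^2 - |T' x|^2)], at most
    [|D_T' x|^2 / (1 - |lambda|^2)], and that of [T] is at least
    [|sum_k lambda^k T^k (T - T') x|^2] ([tails_transfer],
    [resolvent_bound]).

    For the second one, [T] is an isometry and its Toeplitz form is just
    [|sum_k T^k h_k|^2].  By [tails_transfer] again,
    [sum_k T^k h_k = g_0 + sum_k T^k (T - T') g_(k+1)] for the [g] of [T'], so
    it is enough to bound the last sum by [c sum_k |D_T' g_(k+1)|^2].  This is a
    Carleson embedding ([carleson]): solving the resolvent equation at the
    points [r w] for all [P]-th roots of unity [w] and taking discrete Fourier
    coefficients gives a cyclic recursion whose solution approximates the sum,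
    and Parseval turns the resolvent bounds into the required one.

    The operators in the statement are given by choice, so the existence of
    adjoints (Riesz), of [(1 - T^* T)^(1/2)] and of resolvents comes first. *)

(** * Hilbert space geometry over the reals *)

Section HilbertBasics.
Variables (R : realType) (H : hilbertType R).
Implicit Types (x y z : H) (a b : R[i]).

(** Norms and squared norms live in [R[i]]; these are their values in [R], where
    real arithmetic is available. *)
Definition cmod (a : R[i]) : R := complex.Re `|a|.
Definition rnorm x : R := complex.Re `|x|.
Definition rinner x y : R := complex.Re '[x, y].
Definition sqnorm x : R := rinner x x.

Lemma ipDl x y z : '[x + y, z] = '[x, z] + '[y, z].
Proof. exact: linearDl. Qed.
Lemma ipZl a x z : '[a *: x, z] = a * '[x, z].
Proof. exact: linearZl_LR. Qed.
Lemma ipC x y : '[x, y] = conjc '[y, x].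
Proof. by rewrite hermC expr0 mul1r. Qed.
Lemma ipDr x y z : '[x, y + z] = '[x, y] + '[x, z].
Proof. exact: linearD. Qed.
Lemma ipZr a x z : '[x, a *: z] = conjc a * '[x, z].
Proof. exact: linearZr_LR. Qed.
Lemma ip0l x : '[0, x] = 0.
Proof. by rewrite -(scale0r x) ipZl mul0r. Qed.
Lemma ip0r x : '[x, 0] = 0.
Proof. by rewrite ipC ip0l conjc0. Qed.
Lemma ipNl x y : '[- x, y] = - '[x, y].
Proof. by rewrite -scaleN1r ipZl mulN1r. Qed.
Lemma ipNr x y : '[x, - y] = - '[x, y].
Proof. by rewrite ipC ipNl rmorphN /= -ipC. Qed.
Lemma ipBl x y z : '[x - y, z] = '[x, z] - '[y, z].
Proof. by rewrite ipDl ipNl. Qed.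
Lemma ip_suml (I : Type) (r : seq I) (P : pred I) (F : I -> H) y :
  '[\sum_(i <- r | P i) F i, y] = \sum_(i <- r | P i) '[F i, y].
Proof. by apply: (big_morph (fun x => '[x, y])) => [u v|]; [exact: ipDl|exact: ip0l]. Qed.
Lemma ip_sumr (I : Type) (r : seq I) (P : pred I) (F : I -> H) y :
  '[y, \sum_(i <- r | P i) F i] = \sum_(i <- r | P i) '[y, F i].
Proof. by apply: (big_morph (fun x => '[y, x])) => [u v|]; [exact: ipDr|exact: ip0r]. Qed.

Lemma ReD a b : complex.Re (a + b) = complex.Re a + complex.Re b.
Proof. by case: a; case: b. Qed.
Lemma ReN a : complex.Re (- a) = - complex.Re a.
Proof. by case: a. Qed.
Lemma Re_sum (I : Type) (r : seq I) (P : pred I) (F : I -> R[i]) :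
  complex.Re (\sum_(i <- r | P i) F i) = \sum_(i <- r | P i) complex.Re (F i).
Proof. by apply: (big_morph (@complex.Re R)) => // u v; exact: ReD. Qed.
Lemma Re_realM (r : R) a : complex.Re (r%:C * a) = r * complex.Re a.
Proof. by case: a => u v /=; rewrite mul0r subr0. Qed.
Lemma Re_conjc a : complex.Re (conjc a) = complex.Re a.
Proof. by case: a. Qed.

Lemma rinnerDl x y z : rinner (x + y) z = rinner x z + rinner y z.
Proof. by rewrite /rinner ipDl ReD. Qed.
Lemma rinnerDr x y z : rinner x (y + z) = rinner x y + rinner x z.
Proof. by rewrite /rinner ipDr ReD. Qed.
Lemma rinnerNl x y : rinner (- x) y = - rinner x y.
Proof. by rewrite /rinner ipNl ReN. Qed.
Lemma rinnerNr x y : rinner x (- y) = - rinner x y.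
Proof. by rewrite /rinner ipNr ReN. Qed.
Lemma rinnerC x y : rinner x y = rinner y x.
Proof. by rewrite /rinner ipC Re_conjc. Qed.
Lemma rinnerZl (r : R) x y : rinner (r%:C *: x) y = r * rinner x y.
Proof. by rewrite /rinner ipZl Re_realM. Qed.
Lemma rinnerZr (r : R) x y : rinner x (r%:C *: y) = r * rinner x y.
Proof. by rewrite rinnerC rinnerZl rinnerC. Qed.
Lemma sqnormD x y : sqnorm (x + y) = sqnorm x + sqnorm y + 2 * rinner x y.
Proof. rewrite /sqnorm rinnerDl !rinnerDr (rinnerC y x); lra. Qed.
Lemma sqnormB x y : sqnorm (x - y) = sqnorm x + sqnorm y - 2 * rinner x y.
Proof. rewrite /sqnorm rinnerDl !rinnerDr !rinnerNl !rinnerNr (rinnerC y x); lra. Qed.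

Lemma cmodE a : `|a| = (cmod a)%:C.
Proof. by rewrite /cmod RRe_real// normr_real. Qed.
Lemma rnormE x : `|x| = (rnorm x)%:C.
Proof. by rewrite /rnorm RRe_real// normr_real. Qed.
Lemma rnorm_ge0 x : 0 <= rnorm x.
Proof. by rewrite -ler0c -rnormE. Qed.
Lemma cmod_ge0 a : 0 <= cmod a.
Proof. by rewrite -ler0c -cmodE. Qed.
Lemma ip_rnorm_sqr x : '[x, x] = (rnorm x ^+ 2)%:C.
Proof. by rewrite rmorphXn /= -rnormE inner_normE. Qed.
Lemma sqnormE x : sqnorm x = rnorm x ^+ 2.
Proof. by rewrite /sqnorm /rinner ip_rnorm_sqr. Qed.
Lemma sqnorm_ge0 x : 0 <= sqnorm x.
Proof. by rewrite sqnormE sqr_ge0. Qed.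
Lemma rnormD x y : rnorm (x + y) <= rnorm x + rnorm y.
Proof. by rewrite -lecR rmorphD /= -!rnormE ler_normD. Qed.
Lemma rnormZ a x : rnorm (a *: x) = cmod a * rnorm x.
Proof. by apply: complexI; rewrite rmorphM /= -!rnormE -cmodE normrZ. Qed.
Lemma rnormN x : rnorm (- x) = rnorm x.
Proof. by rewrite /rnorm normrN. Qed.
Lemma rnorm0 : rnorm 0 = 0. Proof. by rewrite /rnorm normr0. Qed.
Lemma rnorm_eq0 x : rnorm x = 0 -> x = 0.
Proof. by move=> h; apply/normr0_eq0; rewrite rnormE h. Qed.
Lemma rnorm_sum (I : Type) (r : seq I) (P : pred I) (F : I -> H) :
  rnorm (\sum_(i <- r | P i) F i) <= \sum_(i <- r | P i) rnorm (F i).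
Proof.
elim/big_ind2: _ => [|u s v t h1 h2|//]; first by rewrite rnorm0.
exact: le_trans (rnormD _ _) (lerD h1 h2).
Qed.
Lemma cmodM a b : cmod (a * b) = cmod a * cmod b.
Proof. by apply: complexI; rewrite rmorphM /= -!cmodE normrM. Qed.
Lemma cmodX a n : cmod (a ^+ n) = cmod a ^+ n.
Proof. by apply: complexI; rewrite rmorphXn /= -!cmodE normrX. Qed.
Lemma cmod_real (r : R) : 0 <= r -> cmod r%:C = r.
Proof. by move=> r0; rewrite /cmod ger0_norm// ler0c. Qed.

(** Cauchy-Schwarz comes for free from the triangle inequality, the norm being
    given with the space. *)
Lemma rinner_le x y : rinner x y <= rnorm x * rnorm y.
Proof.
have := rnormD x y; have := rnorm_ge0 x; have := rnorm_ge0 y; have := rnorm_ge0 (x + y).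
have := sqnormD x y; rewrite !sqnormE; nra.
Qed.
Lemma rinner_ge x y : - (rnorm x * rnorm y) <= rinner x y.
Proof. by rewrite -(rnormN x) lerNl -rinnerNl; exact: rinner_le. Qed.

Lemma cvg_rnormP (u : nat -> H) l :
  (u n @[n --> \oo] --> l)%classic <->
  forall e : R, 0 < e -> exists N, forall n, (N <= n)%N -> rnorm (u n - l) <= e.
Proof.
split=> [/cvgrPdist_le ul e e0|ul].
  have [|N _ hN] := ul e%:C; first by rewrite ltcR.
  by exists N => n Nn; rewrite -rnormN opprB -lecR -rnormE; exact: hN.
apply/cvgrPdist_le => e e0.
have er : e = (complex.Re e)%:C by rewrite RRe_real// gtr0_real.
have [|N hN] := ul (complex.Re e); first by rewrite -ltcR -er.
by exists N => // n Nn; rewrite rnormE er lecR -rnormN opprB hN.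
Qed.

Lemma cvg_rinner (u : nat -> H) l y : (u n @[n --> \oo] --> l)%classic ->
  (rinner (u n) y @[n --> \oo] --> rinner l y)%classic.
Proof.
move=> /cvg_rnormP ul; apply/cvgrPdist_le => e e0.
have y1 : 0 < rnorm y + 1 by rewrite ltr_wpDl// rnorm_ge0.
have [N hN] := ul _ (divr_gt0 e0 y1); exists N => // n Nn.
have : rnorm (u n - l) * rnorm y <= e.
  apply: le_trans (_ : rnorm (u n - l) * (rnorm y + 1) <= e).
    by rewrite ler_wpM2l ?rnorm_ge0// lerDl.
  by rewrite -ler_pdivlMr//; exact: hN.
have := rinner_le (u n - l) y; have := rinner_ge (u n - l) y.
by rewrite rinnerDl rinnerNl ler_norml; move=> *; apply/andP; split; lra.
Qed.

Lemma hilbert_complete (u : nat -> H) :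
  (forall e : R, 0 < e -> exists N, forall m n, (N <= m)%N -> (N <= n)%N ->
     rnorm (u m - u n) <= e) ->
  exists l : H, (u n @[n --> \oo] --> l)%classic.
Proof.
move=> hu.
suff /cauchy_cvgP/cvg_ex[l hl] : cauchy (u n @[n --> \oo])%classic by exists l.
apply: cauchy_exP => e e0.
  have er : e = (complex.Re e)%:C by rewrite RRe_real// gtr0_real.
  have e2 : 0 < complex.Re e / 2 by rewrite divr_gt0// -ltcR -er.
  have [N hN] := hu _ e2; exists (u N).
  exists N => //= n /= Nn; rewrite -ball_normE /ball_ /=.
  rewrite rnormE er ltcR (le_lt_trans (hN _ _ _ Nn))//; lra.
Qed.

(** The common reason why the Neumann series and the square root iteration
    converge: a bounded nondecreasing real sequence is Cauchy. *)
Lemma dominated_increments_cvg (u : nat -> H) (s : nat -> R) (b : R) :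
  (forall n, s n <= b) ->
  (forall n m, (n <= m)%N -> rnorm (u m - u n) <= s m - s n) ->
  exists l : H, (u n @[n --> \oo] --> l)%classic.
Proof.
move=> sb us; apply: hilbert_complete => e e0.
have ubs : has_sup (range s)%classic.
  split; first by exists (s 0%N), 0%N.
  by exists b => _ [n _ <-].
have [_ [N _ <-] hN] := sup_adherent (divr_gt0 e0 (ltr0n R 2)) ubs.
exists N => m n Nm Nn.
have lesup k : s k <= sup (range s)%classic.
  by apply: (ub_le_sup ubs.2); exists k.
have -> : u m - u n = (u m - u N) - (u n - u N) by rewrite opprB addrA subrK.
have := rnormD (u m - u N) (- (u n - u N)); rewrite rnormN.
have := us _ _ Nm; have := us _ _ Nn; have := lesup m; have := lesup n.
lra.
Qed.

End HilbertBasics.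

(** * Adjoints, square roots and resolvents *)

Section Operators.
Variables (R : realType) (H : hilbertType R).
Implicit Types (x y z : H).

Lemma inv_succ_small (e : R) : 0 < e -> exists N, forall n, (N <= n)%N -> n.+1%:R^-1 <= e.
Proof.
move=> e0; have [N _ hN] := near_infty_natSinv_lt (PosNum e0).
by exists N => n Nn; apply/ltW; exact: hN.
Qed.

(** The functional is represented by the minimiser of [|z|^2 - 2 g z]: the first
    variation at the minimum vanishes. *)
Lemma riesz_real (g : H -> R) (b : R) :
  (forall x y, g (x + y) = g x + g y) ->
  (forall (r : R) x, g (r%:C *: x) = r * g x) ->
  (forall x, g x <= b * rnorm x) ->
  exists z, forall y, g y = rinner y z.
Proof.
move=> gD gZ gb.
have [I [I_le /choice[u hu]]] : exists I : R, (forall z, I <= sqnorm z - 2 * g z) /\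
    forall n : nat, exists z, sqnorm z - 2 * g z <= I + n.+1%:R^-1.
  pose J z := sqnorm z - 2 * g z.
  have Jinf : has_inf (range J)%classic.
    split; [by exists (J 0), 0|exists (- b ^+ 2) => _ [z _ <-]].
    rewrite /J sqnormE; have := gb z; have := sqr_ge0 (rnorm z - b); nra.
  exists (inf (range J)%classic); split=> [z|n].
    by apply: (ge_inf Jinf.2); exists z.
  have n0 : 0 < n.+1%:R^-1 :> R by rewrite invr_gt0 ltr0n.
  by have [_ [z _ <-] /ltW hz] := inf_adherent n0 Jinf; exists z.
(* The parallelogram identity makes every minimising sequence Cauchy. *)
have [l ul] : exists l : H, (u n @[n --> \oo] --> l)%classic.
  apply: hilbert_complete => e e0.
  have e4 : 0 < e ^+ 2 / 4 by rewrite divr_gt0 ?exprn_gt0.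
  have [N hN] := inv_succ_small e4; exists N => m n Nm Nn.
  have hm := hN _ Nm; have hn := hN _ Nn.
  have := I_le (2^-1%:C *: (u m + u n)).
  rewrite gZ gD /sqnorm rinnerZl rinnerZr -/(sqnorm _) sqnormD.
  have := hu m; have := hu n.
  move=> h1 h2 h3.
  have : sqnorm (u m - u n) <= e ^+ 2.
    by move: (n.+1%:R^-1) (m.+1%:R^-1) h1 h2 hm hn => *; rewrite sqnormB; lra.
  rewrite sqnormE => h; have := rnorm_ge0 (u m - u n); nra.
exists l => y.
have key t : 0 <= t ^+ 2 * sqnorm y + 2 * t * (rinner l y - g y).
  have h1 : (t ^+ 2 * sqnorm y + 2 * t * (rinner (u n) y - g y) + n.+1%:R^-1
     @[n --> \oo] --> t ^+ 2 * sqnorm y + 2 * t * (rinner l y - g y) + 0)%classic.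
    apply: cvgD; last first.
      by apply/cvgrPdist_le => e e0; have [N hN] := inv_succ_small e0; exists N => // n Nn;
         rewrite sub0r normrN ger0_norm ?invr_ge0 ?hN.
    apply: cvgD; first exact: cvg_cst.
    apply: cvgM; first exact: cvg_cst.
    by apply: cvgB; [exact: cvg_rinner|exact: cvg_cst].
  rewrite addr0 in h1; apply: (cvgr_to_ge h1); exists 0%N => // n _ /=.
  have := I_le (u n + t%:C *: y); have := hu n.
  rewrite gD gZ sqnormD rinnerZr /sqnorm rinnerZl rinnerZr -/(sqnorm _) -/(sqnorm _).
  by move: (n.+1%:R^-1) => *; lra.
(* The quadratic [t^2 A + 2 t B] is negative at [t = - B / (A + 1)] unless
   [B = 0]; the denominator is shifted because [A] may vanish. *)
have A0 := sqnorm_ge0 y; set A := sqnorm y in A0 key *.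
set B := _ - _ in key; suff : B = 0 by rewrite rinnerC /B => /subr0_eq ->.
have := key (- B / (A + 1)).
have -> : (- B / (A + 1)) ^+ 2 * A + 2 * (- B / (A + 1)) * B =
   - (B ^+ 2 * ((A + 2) / (A + 1) ^+ 2)) by field; lra.
rewrite oppr_ge0 pmulr_lle0; last by rewrite divr_gt0// ?exprn_gt0//; lra.
by move=> B2; apply/eqP; rewrite -sqrf_eq0 eq_le B2 sqr_ge0.
Qed.

Lemma Im_ip x y : complex.Im '[x, y] = rinner x ('i *: y).
Proof. by rewrite /rinner ipZr; case: '[x, y] => a b /=; ring. Qed.

Lemma ip_rinnerP (x y z t : H) :
  rinner x y = rinner z t -> rinner x ('i *: y) = rinner z ('i *: t) ->
  '[x, y] = '[z, t].
Proof.
by rewrite -!Im_ip /rinner; case: '[x, y] => a b; case: '[z, t] => c d /= -> ->.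
Qed.

Lemma linear_add (A : H -> H) : linear A -> forall x y, A (x + y) = A x + A y.
Proof. by move=> Al x y; rewrite -{1}(scale1r x) Al scale1r. Qed.

Lemma linear_zero (A : H -> H) : linear A -> A 0 = 0.
Proof. by move=> Al; apply: (addrI (A 0)); rewrite -(linear_add Al) !addr0. Qed.

Lemma linear_scale (A : H -> H) : linear A -> forall a x, A (a *: x) = a *: A x.
Proof. by move=> Al a x; rewrite -{1}(addr0 (a *: x)) Al (linear_zero Al) addr0. Qed.

Lemma linear_sub (A : H -> H) : linear A -> forall x y, A (x - y) = A x - A y.
Proof.
by move=> Al x y; rewrite (linear_add Al) -scaleN1r (linear_scale Al) scaleN1r.
Qed.

(** [adjoint] is specified by a choice, so its defining property needs an
    adjoint to exist: apply the Riesz representation to [x |-> '[A x, y]]. *)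
Lemma adjointP (A : H -> H) (b : R) : linear A ->
  (forall x, rnorm (A x) <= b * rnorm x) ->
  forall x y, '[A x, y] = '[x, adjoint A y].
Proof.
move=> Al Ab; rewrite /adjoint.
suff /choice[S hS] : forall y, exists z, forall x, '[A x, y] = '[x, z].
  have hS' : forall x y, '[A x, y] = '[x, S y] by move=> x y; exact: hS.
  exact: (@getPex _ (fun S => forall x y, '[A x, y] = '[x, S y]) (ex_intro _ S hS')).
move=> y.
have [|||z hz] := @riesz_real (fun x => rinner (A x) y) (b * rnorm y).
- by move=> u v; rewrite (linear_add Al) rinnerDl.
- by move=> r u; rewrite (linear_scale Al) rinnerZl.
- move=> x; apply: le_trans (rinner_le _ _) _; rewrite mulrAC.
  by rewrite ler_wpM2r ?rnorm_ge0.
exists z => x; rewrite ipC [RHS]ipC; congr conjc.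
by apply: ip_rinnerP; rewrite -?(linear_scale Al) rinnerC hz rinnerC.
Qed.

Lemma continuous_of_bound (A : H -> H) (b : R) : linear A ->
  (forall x, rnorm (A x) <= b * rnorm x) -> continuous A.
Proof.
move=> Al Ab.
pose A' : {linear H -> H} := HB.pack A (GRing.isLinear.Build R[i] H H *:%R A Al).
apply: (@bounded_linear_continuous _ _ _ A'); apply/linear_boundedP.
exists b%:C; split; first by apply/complex_realP; exists b.
move=> r br x; rewrite !rnormE; apply: le_trans (_ : b%:C * (rnorm x)%:C <= _).
  by rewrite -rmorphM lecR Ab.
by rewrite ler_wpM2r ?ler0c ?rnorm_ge0// ltW.
Qed.

Lemma cvg_rnorm_le (u : nat -> H) l (b : R) : (u n @[n --> \oo] --> l)%classic ->
  (forall n, rnorm (u n) <= b) -> rnorm l <= b.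
Proof.
move=> /cvg_rnormP ul ub; apply/ler_addgt0Pr => e e0; have [N hN] := ul _ e0.
have := hN _ (leqnn N); have := ub N; have := rnormD (u N) (- (u N - l)).
by rewrite rnormN opprB addrC subrK; lra.
Qed.

(** The square root of [1 - B] is [1 - Y], where [Y = (B + Y^2) / 2] is the limit
    of [Y_(n+1) = (B + Y_n^2) / 2].  The numerical iteration
    [s_(n+1) = (1 + s_n^2) / 2], which increases and stays below [1], bounds both
    the iterates and their increments in norm, so no spectral theory is
    involved. *)
Section SquareRoot.
Variable B : H -> H.
Hypothesis B_lin : linear B.
Hypothesis B_le : forall x, rnorm (B x) <= rnorm x.
Hypothesis B_sym : forall x y, rinner (B x) y = rinner x (B y).

Fixpoint sqrt_iter n x : H :=
  if n is n'.+1 then 2^-1%:C *: (B x + sqrt_iter n' (sqrt_iter n' x)) else 0.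

Fixpoint sqrt_bound n : R :=
  if n is n'.+1 then 2^-1 * (1 + sqrt_bound n' ^+ 2) else 0.

Lemma sqrt_bound_itv n : 0 <= sqrt_bound n <= 1.
Proof.
elim: n => [|n /andP[h0 h1]] /=; first by rewrite lexx ler01.
by apply/andP; split; nra.
Qed.

Lemma sqrt_iter_linear n : linear (sqrt_iter n).
Proof.
elim: n => [|n IH] a x y /=; first by rewrite scaler0 addr0.
rewrite B_lin !IH scalerA mulrC -scalerA -scalerDr; congr (_ *: _).
by rewrite scalerDr addrACA.
Qed.

Lemma rnorm_half x : rnorm (2^-1%:C *: x) = 2^-1 * rnorm x.
Proof. by rewrite rnormZ cmod_real. Qed.

Lemma sqrt_iter_le n x : rnorm (sqrt_iter n x) <= sqrt_bound n * rnorm x.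
Proof.
elim: n x => [|n IH] x /=; first by rewrite rnorm0 mul0r.
have /andP[q0 _] := sqrt_bound_itv n.
rewrite rnorm_half -mulrA ler_wpM2l// (le_trans (rnormD _ _))// mulrDl mul1r.
rewrite lerD ?B_le// (le_trans (IH _))// expr2 -mulrA ler_wpM2l//.
Qed.

(** From [S^2 - S'^2 = (S - S') S + S' (S - S')], which has a scalar
    counterpart term by term. *)
Lemma sqrt_iter_step n x :
  rnorm (sqrt_iter n.+1 x - sqrt_iter n x) <= (sqrt_bound n.+1 - sqrt_bound n) * rnorm x.
Proof.
suff [] : 0 <= sqrt_bound n.+1 - sqrt_bound n /\ forall x,
  rnorm (sqrt_iter n.+1 x - sqrt_iter n x) <= (sqrt_bound n.+1 - sqrt_bound n) * rnorm x.
  by move=> _; apply.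
elim: n {x} => [|n [d0 IH]].
  split=> [|x] /=; first by rewrite expr0n /= addr0 subr0 mulr1.
  rewrite subr0 addr0 expr0n /= addr0 subr0 mulr1 rnorm_half.
  by rewrite ler_wpM2l.
have /andP[q0 _] := sqrt_bound_itv n; have /andP[q1 _] := sqrt_bound_itv n.+1.
set s := sqrt_bound n.+1 in d0 IH q1 *; set t := sqrt_bound n in d0 IH q0 *.
have -> : sqrt_bound n.+2 - s = 2^-1 * ((s - t) * s + t * (s - t)).
  by rewrite /s /=; rewrite -/s -/t /=; rewrite /s /=; ring.
split=> [|x]; first by rewrite mulr_ge0// addr_ge0// mulr_ge0.
set S := sqrt_iter n.+1 in IH *; set S' := sqrt_iter n in IH *.
have -> : sqrt_iter n.+2 x - S x = 2^-1%:C *: ((S (S x) - S' (S x)) + S' (S x - S' x)).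
  rewrite [S' (_ - _)](linear_sub (sqrt_iter_linear n)) -/S' addrA subrK.
  rewrite [sqrt_iter n.+2 x]/(2^-1%:C *: (B x + S (S x))).
  rewrite [in X in _ - X = _]/(S x) /= -/S'.
  by rewrite -scalerBr opprD addrACA subrr add0r.
rewrite rnorm_half -mulrA ler_wpM2l// (le_trans (rnormD _ _))// mulrDl lerD//.
  by rewrite (le_trans (IH _))// -mulrA ler_wpM2l// sqrt_iter_le.
by rewrite (le_trans (sqrt_iter_le _ _))// -mulrA ler_wpM2l.
Qed.

Lemma sqrt_op_exists : exists S : H -> H,
  [/\ linear S, continuous S, positive_op S & S \o S = (fun x => x - B x)].
Proof.
have incr x n m : (n <= m)%N ->
    rnorm (sqrt_iter m x - sqrt_iter n x) <= sqrt_bound m * rnorm x - sqrt_bound n * rnorm x.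
  move=> nm; rewrite -(subnK nm); elim: (m - n)%N => [|k IH].
    by rewrite add0n !subrr rnorm0.
  rewrite addSn; have := sqrt_iter_step (k + n) x.
  have := rnormD (sqrt_iter (k + n).+1 x - sqrt_iter (k + n) x)
    (sqrt_iter (k + n) x - sqrt_iter n x).
  rewrite addrA subrK; lra.
have /choice[Y Yl] : forall x, exists l : H, (sqrt_iter n x @[n --> \oo] --> l)%classic.
  move=> x; apply: (dominated_increments_cvg (b := rnorm x)) (incr x) => n.
  by rewrite ler_piMl ?rnorm_ge0//; case/andP: (sqrt_bound_itv n).
have Y_lin : linear Y.
  move=> a x y; apply: (norm_cvg_unique (Yl (a *: x + y))) => /=.
  rewrite (_ : (fun n => _) = fun n => a *: sqrt_iter n x + sqrt_iter n y); last first.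
    by apply/funext => n; rewrite sqrt_iter_linear.
  by apply: cvgD; [apply: cvgZl_tmp; exact: Yl|exact: Yl].
have Y_le x : rnorm (Y x) <= rnorm x.
  apply: cvg_rnorm_le (Yl x) _ => n; rewrite (le_trans (sqrt_iter_le _ _))//.
  by rewrite ler_piMl ?rnorm_ge0//; case/andP: (sqrt_bound_itv n).
have Q_sym n x y : rinner (sqrt_iter n x) y = rinner x (sqrt_iter n y).
  elim: n x y => [|n IH] x y /=; first by rewrite /rinner ip0l ip0r.
  by rewrite rinnerZl rinnerZr rinnerDl rinnerDr B_sym !IH.
have Y_sym x y : rinner (Y x) y = rinner x (Y y).
  apply: (cvg_unique (@Rhausdorff R) (cvg_rinner (y := y) (Yl x))) => /=.
  rewrite (_ : (fun n => _) = fun n => rinner (sqrt_iter n y) x); last first.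
    by apply/funext => n; rewrite Q_sym rinnerC.
  by rewrite rinnerC; exact: cvg_rinner.
have YY x : Y x = 2^-1%:C *: (B x + Y (Y x)).
  have := Yl x; rewrite -cvg_shiftS => h1.
  apply: (norm_cvg_unique h1) => /=.
  apply: cvgZl_tmp; apply: cvgD; first exact: cvg_cst.
  apply/cvg_rnormP => e e0; have e2 : 0 < e / 2 by rewrite divr_gt0.
  have /cvg_rnormP/(_ _ e2)[N1 h1N] := Yl x.
  have /cvg_rnormP/(_ _ e2)[N2 h2N] := Yl (Y x).
  exists (maxn N1 N2) => n; rewrite geq_max => /andP[le1 le2].
  have -> : sqrt_iter n (sqrt_iter n x) - Y (Y x) =
     sqrt_iter n (sqrt_iter n x - Y x) + (sqrt_iter n (Y x) - Y (Y x)).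
    by rewrite (linear_sub (sqrt_iter_linear n)) addrA subrK.
  have := h1N _ le1; have := h2N _ le2 => l2 l1.
  have := rnormD (sqrt_iter n (sqrt_iter n x - Y x)) (sqrt_iter n (Y x) - Y (Y x)).
  have := sqrt_iter_le n (sqrt_iter n x - Y x).
  have : sqrt_bound n * rnorm (sqrt_iter n x - Y x) <= rnorm (sqrt_iter n x - Y x).
    by rewrite ler_piMl ?rnorm_ge0//; case/andP: (sqrt_bound_itv n).
  lra.
have S_lin : linear (fun x => x - Y x).
  by move=> a x y; rewrite Y_lin scalerBr opprD addrACA.
exists (fun x => x - Y x); split=> //.
- apply: (continuous_of_bound (b := 2)) => // x.
  by have := rnormD x (- Y x); rewrite rnormN; have := Y_le x; lra.
- move=> x; rewrite ipBl ip_rnorm_sqr.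
  have : complex.Im '[Y x, x] = 0.
    have := Y_sym x ('i *: x); rewrite -Im_ip (linear_scale Y_lin) -Im_ip [in RHS]ipC.
    by case: '[Y x, x] => u v /=; lra.
  have := rinner_le (Y x) x; have := Y_le x; have := rnorm_ge0 x; rewrite /rinner lecE.
  case: '[Y x, x] => u v /= *; apply/andP; split; first by apply/eqP; lra.
  by nra.
apply/funext => x /=; rewrite (linear_sub Y_lin).
have := YY x => /(congr1 (fun z => 2%:C *: z)).
rewrite scalerA -rmorphM /= divff ?pnatr_eq0// scale1r => h.
have -> : B x = 2%:C *: Y x - Y (Y x) by rewrite h addrK.
have -> : 2%:C *: Y x = Y x + Y x.
  by rewrite (_ : 2%:C = 1 + 1 :> R[i]) ?scalerDl ?scale1r// -[1 in RHS]/(1%:C) -rmorphD.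
by rewrite !opprB opprD !addrA [x - Y x + _]addrAC.
Qed.

End SquareRoot.

Section Contraction.
Variable T : {linear H -> H}.
Hypothesis hT : contractive T.

Lemma contractive_rnorm x : rnorm (T x) <= rnorm x.
Proof. by rewrite -lecR -!rnormE. Qed.

Lemma sqnorm_contractive x : sqnorm (T x) <= sqnorm x.
Proof. by rewrite !sqnormE ler_pXn2r ?nnegrE ?rnorm_ge0// contractive_rnorm. Qed.

(** A positive operator on a complex space is symmetric, so any positive square
    root [D] of [1 - T^* T] satisfies [<D x, D x> = <x, D (D x)>]. *)
Lemma sqnorm_defect x : sqnorm (defect T x) = sqnorm x - sqnorm (T x).
Proof.
have T_lin : linear T by exact: linearP.
have T_le y : rnorm (T y) <= 1 * rnorm y by rewrite mul1r contractive_rnorm.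
have adjT := adjointP T_lin T_le.
pose B y := adjoint T (T y).
have B_ip y z : '[B y, z] = '[T y, T z] by rewrite ipC -adjT -ipC.
have B_lin : linear B.
  move=> a y z; apply/eqP; rewrite -subr_eq0; apply/eqP/rnorm_eq0.
  set d := _ - _; have : '[d, d] = 0.
    by rewrite {1}/d ipBl ipDl ipZl !B_ip T_lin ipDl ipZl subrr.
  by rewrite ip_rnorm_sqr => /complexI/eqP; rewrite sqrf_eq0 => /eqP.
have B_le y : rnorm (B y) <= rnorm y.
  have := rinner_le (T y) (T (B y)); rewrite /rinner -B_ip -/(rinner _ _) -/(sqnorm _) sqnormE.
  have := contractive_rnorm y; have := contractive_rnorm (B y).
  have := rnorm_ge0 (B y); have := rnorm_ge0 y; have := rnorm_ge0 (T y). 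
  have := rnorm_ge0 (T (B y)); nra.
have B_sym y z : rinner (B y) z = rinner y (B z).
  by rewrite [RHS]rinnerC /rinner !B_ip -!/(rinner _ _) rinnerC.
have [S hS] := sqrt_op_exists B_lin B_le B_sym.
have [D_lin _ D_pos D2] := @getPex _ (fun S => [/\ linear S, continuous S, positive_op S
  & S \o S = (fun x => x - B x)]) (ex_intro _ S hS).
rewrite -/(sqrt_op (fun x => x - B x)) -/(defect T) in D_lin D_pos D2.
have D_sym y z : rinner (defect T y) z = rinner y (defect T z).
  have Im0 w : complex.Im '[defect T w, w] = 0 by apply: ger0_Im; exact: D_pos.
  have := Im0 (y + 'i *: z).
  rewrite (linear_add D_lin) ipDl !ipDr (linear_scale D_lin) !ipZl !ipZr.
  have := Im0 y; have := Im0 z; rewrite [rinner y _]rinnerC /rinner.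
  case: '[defect T y, y] => a1 b1; case: '[defect T z, z] => a2 b2.
  case: '[defect T y, z] => a3 b3; case: '[defect T z, y] => a4 b4 /=; lra.
rewrite /sqnorm D_sym -[defect T (defect T x)]/((defect T \o defect T) x) D2.
by rewrite rinnerDr rinnerNr [rinner x (B x)]rinnerC /rinner B_ip.
Qed.

(** The Neumann series of [y] converges by [dominated_increments_cvg], its
    increments being bounded by those of a geometric series. *)
Lemma resolvent_solvable (a : R[i]) y : cmod a < 1 -> exists x, x - a *: T x = y.
Proof.
move=> a1; pose u := fix u n := if n is n'.+1 then y + a *: T (u n') else 0.
have step n : rnorm (u n.+1 - u n) <= cmod a ^+ n * rnorm y.
  elim: n => [|n IH]; first by rewrite /= linear0 scaler0 addr0 subr0 expr0 mul1r.
  rewrite [u n.+2]/= -/(u n.+1) [in X in _ - X]/= opprD addrACA subrr add0r -scalerBr.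
  rewrite -linearB rnormZ exprS -mulrA ler_wpM2l ?cmod_ge0//.
  exact: le_trans (contractive_rnorm _) IH.
have [l ul] : exists l : H, (u n @[n --> \oo] --> l)%classic.
  pose s n := (1 - cmod a ^+ n) / (1 - cmod a) * rnorm y.
  have c1 : 0 < 1 - cmod a by rewrite subr_gt0.
  apply: (dominated_increments_cvg (s := s) (b := (1 - cmod a)^-1 * rnorm y)) => [n|n m nm].
    rewrite /s ler_wpM2r ?rnorm_ge0// ler_piMl ?invr_ge0 ?(ltW c1)//.
    by rewrite gerBl exprn_ge0 ?cmod_ge0.
  rewrite -(subnK nm); elim: (m - n)%N => [|k IH]; first by rewrite add0n !subrr rnorm0.
  rewrite addSn; have := step (k + n)%N.
  have := rnormD (u (k + n).+1 - u (k + n)%N) (u (k + n)%N - u n).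
  rewrite addrA subrK.
  have -> : cmod a ^+ (k + n) * rnorm y = s (k + n).+1 - s (k + n)%N.
    by rewrite /s exprS; field; rewrite gt_eqF.
  lra.
exists l; suff {1}-> : l = y + a *: T l by rewrite addrK.
have := ul; rewrite -cvg_shiftS => h1.
apply: (norm_cvg_unique h1) => /=; apply: cvgD; first exact: cvg_cst.
apply: cvgZl_tmp; apply/cvg_rnormP => e e0; have /cvg_rnormP/(_ _ e0)[N hN] := ul.
exists N => n Nn; rewrite -linearB (le_trans (contractive_rnorm _))//; exact: hN.
Qed.

Lemma resolvent_inj (a : R[i]) x z : cmod a < 1 ->
  x - a *: T x = z - a *: T z -> x = z.
Proof.
move=> a1 h; apply/eqP; rewrite -subr_eq0; apply/eqP/rnorm_eq0.
have : rnorm (x - z) <= cmod a * rnorm (x - z).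
  have e : x - z = a *: T (x - z).
    rewrite linearB scalerBr; apply/eqP; rewrite -subr_eq0 opprB.
    by rewrite [_ - a *: T x]addrC addrACA h [- z + _]addrC -opprB addNr.
  rewrite {1}e rnormZ ler_wpM2l ?cmod_ge0//; exact: contractive_rnorm.
by have := rnorm_ge0 (x - z); nra.
Qed.

Lemma inv_op_resolvent (a : R[i]) y : cmod a < 1 ->
  let x := inv_op (fun x => x - a *: T x) y in x - a *: T x = y.
Proof.
move=> a1.
have /choice[S hS] := fun y => resolvent_solvable y a1.
have hS' : cancel (fun x => x - a *: T x) S /\ cancel S (fun x => x - a *: T x).
  by split=> [x|x]; [apply: (resolvent_inj a1); rewrite hS|rewrite hS].
have [_ h] := @getPex _ (fun S => cancel (fun x => x - a *: T x) S /\
  cancel S (fun x => x - a *: T x)) (ex_intro _ S hS').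
exact: h.
Qed.

End Contraction.
End Operators.

(** * Toeplitz and Fejer forms of a contraction *)

Section Forms.
Variables (R : realType) (H : hilbertType R).
Implicit Types (x y : H) (z : R[i]) (T : {linear H -> H}).

Lemma Re_natM n (a : R[i]) : complex.Re (n%:R * a) = n%:R * complex.Re a.
Proof. by rewrite -(rmorph_nat (real_complex R)) Re_realM. Qed.

Lemma iter_is_linear T k : linear (iter k T).
Proof. by elim: k => [|k IH] a x y //=; rewrite IH linearP. Qed.

HB.instance Definition _ T k :=
  GRing.isLinear.Build R[i] H H *:%R (iter k T) (iter_is_linear T k).

(** The component in [H] of [sum_k V^k h_(m+k)], for an isometric dilation [V]
    of [T] that lifts it. *)
Definition tails T (h : nat -> H) (N m : nat) : H :=
  \sum_(k < N) iter k T (h (m + k)%N).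

(** The Toeplitz form [|sum_k V^k h_k|^2 = sum_(m,n) <T^(n-m) h_n, h_m>], with
    [T^(-k)] read as the adjoint of [T^k]: the diagonal and twice the real part
    of the upper triangle, summed row by row. *)
Definition toeplitz T (h : nat -> H) (N : nat) : R :=
  \sum_(m < N) (2 * rinner (tails T h N m) (h m) - sqnorm (h m)).

Lemma tails_rec T h N m : (forall k, (N <= k)%N -> h k = 0) ->
  tails T h N m = h m + T (tails T h N m.+1).
Proof.
move=> h0; rewrite /tails; case: N h0 => [|N] h0.
  by rewrite !big_ord0 linear0 addr0 h0.
rewrite [in LHS]big_ord_recl addn0 [in RHS]big_ord_recr /=.
rewrite (h0 (m.+1 + N)%N) ?linear0 ?addr0; last first.
  by rewrite addSnnS leq_addl.
rewrite linear_sum; congr (_ + _); apply: eq_bigr => k _ /=.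
by rewrite /bump /= add1n addnS.
Qed.

Lemma tails_ge T h N m : (forall k, (N <= k)%N -> h k = 0) -> (N <= m)%N ->
  tails T h N m = 0.
Proof.
move=> h0 Nm; apply: big1 => k _.
by rewrite h0 ?linear0// (leq_trans Nm)// leq_addr.
Qed.

(** With [h_m = g_m - T g_(m+1)], row [m] is [|g_m|^2 - |T g_(m+1)|^2]. *)
Lemma toeplitz_tails T h N : (forall k, (N <= k)%N -> h k = 0) ->
  toeplitz T h N = sqnorm (tails T h N 0) +
    \sum_(m < N) (sqnorm (tails T h N m.+1) - sqnorm (T (tails T h N m.+1))).
Proof.
move=> h0; pose g := tails T h N; rewrite -/(g 0%N).
have -> : toeplitz T h N = \sum_(m < N) (sqnorm (g m) - sqnorm (T (g m.+1))).
  apply: eq_bigr => m _; have gm := tails_rec T m h0; rewrite -/(g _) in gm *.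
  have -> : h m = g m - T (g m.+1) by rewrite gm addrK.
  rewrite sqnormB rinnerDr rinnerNr -/(sqnorm _); lra.
rewrite !sumrB addrA; congr (_ - _).
rewrite -[RHS](big_ord_recl N (fun m : 'I_N.+1 => sqnorm (g m))) big_ord_recr /=.
by rewrite /g tails_ge// /sqnorm /rinner ip0l addr0.
Qed.

(** The twice-or-once weights come from grouping the frequencies [k] and [-k]
    of the Fejer kernel. *)
Definition fejer_weight (M k : nat) : R[i] := ((M - k) * (k != 0).+1)%:R.

(** [M] times the Fejer mean of order [M] of [sum_(k in Z) z^k T^k], where
    [T^(-k)] is the adjoint of [T^k], as a quadratic form in [x]. *)
Definition fejer T (M : nat) (z : R[i]) x : R :=
  complex.Re (\sum_(k < M) fejer_weight M k * (z ^+ k * '[iter k T x, x])).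

Lemma fejer_weight_step M (a : nat -> R[i]) :
  \sum_(k < M.+1) fejer_weight M.+1 k * a k =
  \sum_(k < M) fejer_weight M k * a k + (2 * (\sum_(k < M.+1) a k) - a 0%N).
Proof.
have -> : \sum_(k < M) fejer_weight M k * a k = \sum_(k < M.+1) fejer_weight M k * a k.
  by rewrite big_ord_recr /= [fejer_weight M M]/fejer_weight subnn mul0n mul0r addr0.
rewrite [X in 2 * X]big_ord_recl !big_ord_recl /= mulrDr.
rewrite [X in X - _](_ : _ = 2 * a 0%N + \sum_(i < M) 2 * a (lift ord0 i)); last first.
  by rewrite mulr_sumr.
have -> : \sum_(i < M) fejer_weight M.+1 (lift ord0 i) * a (lift ord0 i) =
  \sum_(i < M) fejer_weight M (lift ord0 i) * a (lift ord0 i) +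
  \sum_(i < M) 2 * a (lift ord0 i).
  rewrite -big_split /=; apply: eq_bigr => i _; rewrite -mulrDl; congr (_ * _).
  by rewrite /fejer_weight -[2]/(2%:R) -natrD /bump /=; congr (_%:R); have := ltn_ord i; lia.
rewrite /fejer_weight !subn0 !muln1 -natr1; ring.
Qed.

(** The Fejer kernel as a sum of Dirichlet kernels. *)
Lemma fejer_weight_sum M (a : nat -> R[i]) :
  \sum_(k < M) fejer_weight M k * a k =
  \sum_(m < M) (2 * (\sum_(k < M - m) a k) - a 0%N).
Proof.
elim: M => [|M IH]; first by rewrite !big_ord0.
by rewrite fejer_weight_step IH [RHS]big_ord_recl /= addrC.
Qed.

Lemma cmod_sqr (a : R[i]) : cmod a ^+ 2 = complex.Re a ^+ 2 + complex.Im a ^+ 2.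
Proof. by apply: complexI; rewrite add_Re2_Im2 cmodE -rmorphXn. Qed.

(** The right-hand side is the Toeplitz form of the family [1, ..., 1] for the
    scalar contraction [v], and a Toeplitz form dominates [|g_0|^2]; hence the
    Fejer kernel has nonnegative real part in the whole closed disc. *)
Lemma fejer_kernel_ge M (v : R[i]) : cmod v <= 1 ->
  cmod (\sum_(k < M) v ^+ k) ^+ 2 <= complex.Re (\sum_(k < M) fejer_weight M k * v ^+ k).
Proof.
move=> v1; elim: M => [|M IH]; first by rewrite !big_ord0 cmod_sqr /= expr0n /= addr0.
rewrite (fejer_weight_step M (fun k => v ^+ k)) ReD big_ord_recl /= expr0.
set S := \sum_(k < M) _ in IH *; set F := complex.Re _ in IH *.
have -> : \sum_(i < M) v ^+ bump 0 i = v * S.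
  by rewrite /S mulr_sumr; apply: eq_bigr => i _; rewrite -exprS.
have : cmod (v * S) ^+ 2 <= cmod S ^+ 2.
  rewrite cmodM exprMn ler_piMl ?sqr_ge0// expr_le1 ?cmod_ge0//.
rewrite (cmod_sqr (v * S)) (cmod_sqr (1 + _)).
have -> : 2 * (1 + v * S) - 1 = 1 + (v * S) + (v * S) by ring.
case: (v * S) => p q; rewrite !ReD /=; nra.
Qed.

Lemma ip_sqnorm x : '[x, x] = (sqnorm x)%:C.
Proof. by rewrite ip_rnorm_sqr sqnormE. Qed.

Lemma sqnormZ a x : sqnorm (a *: x) = cmod a ^+ 2 * sqnorm x.
Proof. by rewrite !sqnormE rnormZ exprMn. Qed.

Lemma conjc_unit (a : R[i]) : cmod a = 1 -> a * conjc a = 1.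
Proof.
move=> a1; have := cmod_sqr a; rewrite a1 expr1n.
case: a {a1} => p q /= h; apply/eqP; rewrite eq_complex /=.
by apply/andP; split; apply/eqP; [rewrite h; ring|ring].
Qed.

(** The Toeplitz matrix of the geometric family [z^k x] is constant along
    diagonals, and diagonal [k] has [M - k] entries. *)
Lemma fejer_toeplitz T M z x : cmod z = 1 ->
  fejer T M z x = toeplitz T (fun k => if (k < M)%N then z ^+ k *: x else 0) M.
Proof.
move=> z1; rewrite /fejer (fejer_weight_sum M (fun k => z ^+ k * '[iter k T x, x])).
rewrite Re_sum; apply: eq_bigr => m _ /=.
rewrite ltn_ord sqnormZ cmodX z1 !expr1n mul1r expr0 mul1r ip_sqnorm ReD ReN /=.
congr (_ - _); rewrite (Re_natM 2); congr (_ * _).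
rewrite /rinner ip_suml; congr complex.Re.
have mM := ltnW (ltn_ord m).
rewrite (big_ord_widen M (fun k => z ^+ k * '[iter k T x, x])) ?leq_subr//.
rewrite [LHS]big_mkcond /=; apply: eq_bigr => k _.
rewrite ltn_subRL; case: ifP => _; last by rewrite linear0 ip0l.
rewrite [iter k T (_ *: _)]linearZ ipZl ipZr mulrA; congr (_ * _).
by rewrite exprD mulrAC rmorphXn /= -exprMn conjc_unit// expr1n mul1r.
Qed.

End Forms.

(** * Averaging over roots of unity *)

Section Averages.
Variables (R : realType) (H : hilbertType R).
Implicit Types (x y : H) (z : R[i]) (T : {linear H -> H}).

(** Stated for powers of the nodes [z^j], so that it reads as the orthogonality
    of the characters [w |-> w^a] on the nodes [w]. *)
Definition discrete_orthogonal (P : nat) (z : R[i]) :=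
  forall a b, (a < P)%N -> (b < P)%N ->
  \sum_(j < P) (z ^+ j) ^+ a * conjc ((z ^+ j) ^+ b) = if a == b then P%:R else 0.

Lemma root_of_unity_orthogonal P : (0 < P)%N ->
  exists z, [/\ cmod z = 1, z ^+ P = 1 & discrete_orthogonal P z].
Proof.
move=> P0.
have [z zP] : exists z : R[i], P.-primitive_root z.
  pose p : {poly R[i]} := 'X^P - 1; have [r Dp] := closed_field_poly_normal p.
  rewrite (monicP _) ?monicXnsubC // scale1r in Dp.
  have rn1: all P.-unity_root r by apply/allP=> z; rewrite -root_prod_XsubC -Dp.
  have sz_r: (P < (size r).+1)%N.
    by rewrite -(size_prod_XsubC r id) -Dp size_XnsubC.
  have [|z] := hasP (has_prim_root P0 rn1 _ sz_r); last by exists z.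
  by rewrite -separable_prod_XsubC -Dp separable_Xn_sub_1 // pnatr_eq0 -lt0n.
have z1 : cmod z = 1.
  have := cmodX z P; rewrite (prim_expr_order zP) (cmod_real ler01) => /esym h.
  by apply/eqP; rewrite -(pexpr_eq1 P0 (cmod_ge0 z)) h.
exists z; split=> //; first exact: prim_expr_order.
move=> a b aP bP.
have -> : \sum_(j < P) (z ^+ j) ^+ a * conjc ((z ^+ j) ^+ b) =
    \sum_(j < P) (z ^+ a * conjc (z ^+ b)) ^+ j.
  by apply: eq_bigr => j _; rewrite (exprAC z _ a) (exprAC z _ b) exprMn -[in RHS]rmorphXn.
have u1 n : z ^+ n * conjc (z ^+ n) = 1 by apply: conjc_unit; rewrite cmodX z1 expr1n.
case: eqP => [->|/eqP ab].
  under eq_bigr do rewrite u1 expr1n.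
  by rewrite sumr_const card_ord.
set q := _ * _; have q1 : q != 1.
  apply: contra ab => /eqP qE.
  have : z ^+ a = z ^+ b by rewrite -[LHS]mulr1 -(u1 b) [z ^+ b * _]mulrC mulrA -/q qE mul1r.
  by move/eqP; rewrite (eq_prim_root_expr zP) !modn_small.
have qP : q ^+ P = 1.
  have zX n : (z ^+ n) ^+ P = 1 by rewrite exprAC (prim_expr_order zP) expr1n.
  by rewrite exprMn zX -rmorphXn /= zX conjc1 mulr1.
have := subrX1 q P; rewrite qP subrr => /esym/eqP; rewrite mulf_eq0 subr_eq0 (negbTE q1) /=.
by move/eqP.
Qed.

Lemma discrete_orthogonal_conj P z : discrete_orthogonal P z -> discrete_orthogonal P (conjc z).
Proof.
move=> zo a b aP bP; have := zo b a bP aP; rewrite eq_sym => <-.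
by apply: eq_bigr => j _; rewrite -!rmorphXn /= conjcK mulrC.
Qed.

Lemma parseval P z (u : nat -> H) : discrete_orthogonal P z ->
  \sum_(j < P) sqnorm (\sum_(n < P) (z ^+ j) ^+ n *: u n) = P%:R * \sum_(n < P) sqnorm (u n).
Proof.
move=> zo; apply: complexI; rewrite rmorphM rmorph_nat !rmorph_sum /= mulr_sumr.
have -> : \sum_(j < P) (sqnorm (\sum_(n < P) (z ^+ j) ^+ n *: u n))%:C =
  \sum_(n < P) \sum_(m < P) (\sum_(j < P) (z ^+ j) ^+ n * conjc ((z ^+ j) ^+ m)) * '[u n, u m].
  under eq_bigr => j _.
    rewrite -ip_sqnorm ip_suml.
    under eq_bigr => n _.
      rewrite ip_sumr; under eq_bigr => m _ do rewrite ipZl ipZr mulrA.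
      over.
    over.
  rewrite exchange_big /=; apply: eq_bigr => n _.
  rewrite exchange_big /=; apply: eq_bigr => m _.
  by rewrite -mulr_suml.
apply: eq_bigr => n _; rewrite (bigD1 n) //= zo// eqxx ip_sqnorm big1 ?addr0// => m mn.
by rewrite zo// eq_sym -val_eqE /= in mn *; rewrite (negbTE mn) mul0r.
Qed.

(** Averaging the Fejer forms of the vectors [sum_n w^n h_n] against
    [conj w] isolates the Toeplitz form of [h], up to a term [d] that does not
    grow with [M]. *)
Lemma fejer_average T (h : nat -> H) N : (forall k, (N <= k)%N -> h k = 0) ->
  exists d, forall M P z, (N <= M)%N -> (N + M < P)%N -> cmod z = 1 ->
    discrete_orthogonal P z ->
  \sum_(j < P) fejer T M (conjc (z ^+ j)) (\sum_(n < N) (z ^+ j) ^+ n *: h n) =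
  P%:R * (M%:R * toeplitz T h N - d).
Proof.
move=> h0.
pose t m k := '[iter k T (h (m + k)%N), h m].
exists (complex.Re (\sum_(m < N) \sum_(k < N) (k * (k != 0 :> nat).+1)%:R * t m k)).
move=> M P z NM NMP z1 zo.
have expand w : \sum_(k < M) fejer_weight R M k * ((conjc w) ^+ k *
     '[iter k T (\sum_(n < N) w ^+ n *: h n), \sum_(n < N) w ^+ n *: h n]) =
   \sum_(m < N) \sum_(k < M) \sum_(n < N) fejer_weight R M k *
     ('[iter k T (h n), h m] * (w ^+ n * conjc (w ^+ (m + k)))).
  rewrite [RHS]exchange_big /=; apply: eq_bigr => k _.
  rewrite ip_sumr !mulr_sumr; apply: eq_bigr => m _.
  rewrite linear_sum ip_suml !mulr_sumr; apply: eq_bigr => n _ /=.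
  rewrite [iter k T (_ *: _)]linearZ ipZl ipZr; congr (_ * _).
  by rewrite !rmorphXn /= exprD; ring.
rewrite /fejer -Re_sum; under eq_bigr do rewrite expand.
rewrite exchange_big /=.
have -> : \sum_(m < N) \sum_(j < P) \sum_(k < M) \sum_(n < N) fejer_weight R M k *
     ('[iter k T (h n), h m] * ((z ^+ j) ^+ n * conjc ((z ^+ j) ^+ (m + k)))) =
   P%:R * \sum_(m < N) \sum_(k < M) fejer_weight R M k * t m k.
  rewrite mulr_sumr; apply: eq_bigr => m _.
  rewrite exchange_big mulr_sumr; apply: eq_bigr => k _ /=.
  have mP : (m + k < P)%N.
    exact: leq_ltn_trans (leq_add (ltnW (ltn_ord m)) (ltnW (ltn_ord k))) NMP.
  have nP (n : 'I_N) : (n < P)%N.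
    by apply: leq_ltn_trans NMP; rewrite (leq_trans (ltnW (ltn_ord n)))// leq_addr.
  transitivity (fejer_weight R M k * \sum_(n < N) '[iter k T (h n), h m] *
      (if n == (m + k)%N :> nat then P%:R else 0)).
    rewrite exchange_big mulr_sumr; apply: eq_bigr => n _ /=.
    by rewrite -(zo _ _ (nP n) mP) -mulr_sumr -mulr_sumr.
  rewrite mulrCA; congr (_ * _).
  rewrite /t; have [mkN|mkN] := ltnP (m + k) N; last first.
    rewrite (h0 _ mkN) linear0 ip0l mulr0 big1// => n _.
    by rewrite ifF ?mulr0//; apply/negbTE; rewrite neq_ltn (leq_trans (ltn_ord n)).
  rewrite (bigD1 (Ordinal mkN)) //= eqxx mulrC big1 ?addr0// => n nmk.
  by rewrite ifF ?mulr0//; apply/negbTE; apply: contra nmk => /eqP e; apply/eqP/val_inj.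
rewrite Re_natM; congr (_ * _).
rewrite /toeplitz !Re_sum mulr_sumr -sumrB; apply: eq_bigr => m _.
have t0 k : (N <= k)%N -> t m k = 0.
  by move=> Nk; rewrite /t (h0 (m + k)%N (leq_trans Nk (leq_addl _ _))) linear0 ip0l.
have E : \sum_(k < M) fejer_weight R M k * t m k +
    \sum_(k < N) (k * (k != 0 :> nat).+1)%:R * t m k =
    M%:R * (2%:R * \sum_(k < N) t m k - t m 0%N).
  have -> : \sum_(k < M) fejer_weight R M k * t m k = \sum_(k < N) fejer_weight R M k * t m k.
    rewrite (big_ord_widen M (fun k => fejer_weight R M k * t m k) NM) [RHS]big_mkcond /=.
    by apply: eq_bigr => k _; case: ltnP => // /t0 ->; rewrite mulr0.
  rewrite -big_split /=.
  have -> : \sum_(k < N) (fejer_weight R M k * t m k + (k * (k != 0 :> nat).+1)%:R * t m k) =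
     \sum_(k < N) M%:R * ((k != 0 :> nat).+1%:R * t m k).
    apply: eq_bigr => k _; rewrite -mulrDl mulrA -natrM; congr (_ * _).
    rewrite /fejer_weight -natrD -mulnDl; congr (_ * _)%:R.
    by rewrite subnK// (leq_trans (ltnW (ltn_ord k))).
  rewrite -mulr_sumr; congr (_ * _).
  case: N m @t h0 NM NMP t0 {expand} => [[]//|N'] m t _ _ _ _.
  rewrite !big_ord_recl /= mul1r mulrDr mulr_sumr; ring.
have := congr1 (@complex.Re R) E; rewrite ReD Re_natM ReD ReN Re_natM => E'.
have -> : rinner (tails T h N m) (h m) = complex.Re (\sum_(k < N) t m k).
  by rewrite /rinner ip_suml.
have -> : sqnorm (h m) = complex.Re (t m 0%N) by rewrite /t addn0.
by rewrite -E' addrK.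
Qed.

Lemma poly_opE (p : {poly R[i]}) T N x : (size p <= N)%N ->
  poly_op p T x = \sum_(k < N) p`_k *: iter k T x.
Proof.
move=> pN; rewrite /poly_op (big_ord_widen N (fun k => p`_k *: iter k T x) pN).
rewrite big_mkcond /=; apply: eq_bigr => k _.
by case: ltnP => // pk; rewrite nth_default// scale0r.
Qed.

(** The weighted averages of the Fejer forms of a single vector recover
    [Re <p(T) x, x>], again up to a term that does not grow. *)
Lemma fejer_poly_average (p : {poly R[i]}) T x : exists d, forall M P z,
  (size p <= M)%N -> (M + M < P)%N -> discrete_orthogonal P z ->
  \sum_(j < P) complex.Re p.[z ^+ j] * fejer T M (conjc (z ^+ j)) x =
  P%:R * (M%:R * rinner (poly_op p T x) x - d).
Proof.
pose t k := '[iter k T x, x].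
exists (complex.Re (\sum_(k < size p) k%:R * (p`_k * t k))) => M P z pM MP zo.
have MP' : (M < P)%N by apply: leq_ltn_trans MP; rewrite leq_addr.
have P0 : (0 < P)%N by apply: leq_ltn_trans MP'.
have S1 k : (k < M)%N -> \sum_(j < P) conjc ((z ^+ j) ^+ k) * p.[z ^+ j] = P%:R * p`_k.
  move=> kM; under eq_bigr do rewrite (horner_coef_wide _ pM) mulr_sumr.
  rewrite exchange_big (bigD1 (Ordinal kM)) //= [X in _ + X]big1 ?addr0 => [|i ik].
    under eq_bigr do rewrite mulrCA [_^* * _]mulrC.
    by rewrite -mulr_sumr zo ?eqxx ?(ltn_trans kM)// mulrC.
  under eq_bigr do rewrite mulrCA [_^* * _]mulrC.
  rewrite -mulr_sumr zo ?(ltn_trans _ MP')// ifF ?mulr0//.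
  by apply/negbTE; apply: contra ik => /eqP e; apply/eqP/val_inj.
have S2 k : (k < M)%N -> \sum_(j < P) conjc ((z ^+ j) ^+ k) * conjc p.[z ^+ j] =
    if k == 0%N then P%:R * conjc p`_0 else 0.
  move=> kM; have M0 : (0 < M)%N by apply: leq_ltn_trans kM.
  transitivity (conjc (\sum_(i < M) p`_i * (if (k + i == 0)%N then P%:R else 0))).
    rewrite (_ : \sum_(i < M) _ = \sum_(j < P) (z ^+ j) ^+ k * p.[z ^+ j]).
      by rewrite rmorph_sum /=; apply: eq_bigr => j _; rewrite rmorphM.
    under [RHS]eq_bigr do rewrite (horner_coef_wide _ pM) mulr_sumr.
    rewrite exchange_big /=; apply: eq_bigr => i _.
    rewrite -(zo (k + i)%N 0%N) ?(leq_ltn_trans _ MP) ?leq_add ?(ltnW kM) ?(ltnW (ltn_ord i))//.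
    rewrite mulr_sumr; apply: eq_bigr => j _.
    by rewrite expr0 conjc1 mulr1 exprD; ring.
  case: eqP => [->|k0].
    rewrite (bigD1 (Ordinal M0)) //= ?add0n ?eqxx big1 ?addr0 => [|i i0].
      by rewrite rmorphM /= conjc_nat mulrC.
    rewrite ?add0n ifF ?mulr0//.
    by apply/negbTE; apply: contra i0 => /eqP e; apply/eqP/val_inj.
  rewrite big1 ?conjc0// => i _; rewrite ifF ?mulr0//.
  by apply/negbTE; rewrite addn_eq0; case: (k == 0%N) / eqP k0.
have twice : 2%:R * \sum_(j < P) complex.Re p.[z ^+ j] * fejer T M (conjc (z ^+ j)) x =
  complex.Re (\sum_(k < M) fejer_weight R M k * (t k *
    (P%:R * p`_k + (if k == 0 :> nat then P%:R * conjc p`_0 else 0)))).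
  transitivity (complex.Re (\sum_(k < M) fejer_weight R M k * (t k *
     \sum_(j < P) conjc ((z ^+ j) ^+ k) * (p.[z ^+ j] + conjc p.[z ^+ j])))).
    under [in RHS]eq_bigr do rewrite !mulr_sumr.
    rewrite exchange_big Re_sum mulr_sumr; apply: eq_bigr => j _ /=.
    rewrite /fejer -Re_realM -Re_natM addcJ; congr complex.Re.
    rewrite !mulr_sumr; apply: eq_bigr => k _.
    by rewrite !rmorphXn /= -/(t k); ring.
  congr complex.Re; apply: eq_bigr => k _; rewrite -S1// -S2//.
  by rewrite -big_split /=; congr (_ * (_ * _)); apply: eq_bigr => j _; rewrite mulrDr.
have two0 : 2%:R != 0 :> R by rewrite pnatr_eq0.
apply: (mulfI two0); rewrite twice Re_sum.
have -> : rinner (poly_op p T x) x = complex.Re (\sum_(k < size p) p`_k * t k).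
  by rewrite /rinner (poly_opE T x (leqnn _)) ip_suml; under eq_bigr do rewrite ipZl.
have -> : M%:R * complex.Re (\sum_(k < size p) p`_k * t k) -
    complex.Re (\sum_(k < size p) k%:R * (p`_k * t k)) =
    \sum_(k < M) (M - k)%:R * complex.Re (p`_k * t k).
  rewrite !Re_sum mulr_sumr -sumrB.
  rewrite (big_ord_widen M (fun k => M%:R * complex.Re (p`_k * t k) -
      complex.Re (k%:R * (p`_k * t k))) pM) [LHS]big_mkcond /=.
  apply: eq_bigr => k _; case: ltnP => pk; last by rewrite nth_default// mul0r mulr0.
  by rewrite Re_natM -mulrBl natrB// ltnW.
rewrite !mulr_sumr; apply: eq_bigr => k _; rewrite /fejer_weight.
case: (nat_of_ord k) => [|k'] /=.
  rewrite subn0 muln1 Re_natM /t /= ip_sqnorm -mulrDr -[_ * (P%:R * _)]mulrCA Re_natM.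
  by rewrite Re_realM ReD Re_conjc [p`_0 * _]mulrC Re_realM; ring.
by rewrite addr0 Re_natM mulrCA Re_natM [t _ * _]mulrC natrM; ring.
Qed.

End Averages.

(** * Harnack domination, Fejer forms and Toeplitz forms *)

Section Harnack.
Variables (R : realType) (H : hilbertType R).
Implicit Types (x y : H) (z : R[i]) (T : {linear H -> H}).

(** The limit [M -> oo] in both averaging arguments. *)
Lemma le_of_linear_growth (a b d : R) N :
  (forall M, (N <= M)%N -> M%:R * a <= M%:R * b + d) -> a <= b.
Proof.
move=> h; rewrite leNgt; apply/negP => ba.
have ab : 0 < a - b by rewrite subr_gt0.
pose M := maxn N (Num.bound (`|d| / (a - b))).
have := h M (leq_maxl _ _); apply/negP; rewrite -ltNge.
have : `|d| / (a - b) < M%:R.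
  have /archi_boundP/lt_le_trans : 0 <= `|d| / (a - b) by rewrite divr_ge0// ltW.
  by apply; rewrite ler_nat leq_maxr.
rewrite ltr_pdivrMr// => /(le_lt_trans (ler_norm d)); lra.
Qed.

Lemma poly_op_linear (p : {poly R[i]}) T : linear (poly_op p T).
Proof.
move=> a x y; rewrite /poly_op scaler_sumr -big_split /=; apply: eq_bigr => k _.
by rewrite linearP scalerDr !scalerA mulrC.
Qed.

Lemma iter_contractive T k x : contractive T -> rnorm (iter k T x) <= rnorm x.
Proof.
by move=> hT; elim: k => //= k IH; exact: le_trans (contractive_rnorm hT _) IH.
Qed.

Lemma poly_op_bounded (p : {poly R[i]}) T x : contractive T ->
  rnorm (poly_op p T x) <= (\sum_(k < size p) cmod p`_k) * rnorm x.
Proof.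
move=> hT; rewrite mulr_suml (le_trans (rnorm_sum _ _ _))//.
by apply: ler_sum => k _; rewrite rnormZ ler_wpM2l ?cmod_ge0// iter_contractive.
Qed.

Lemma Re_op_poly (p : {poly R[i]}) T x : contractive T ->
  '[Re_op (poly_op p T) x, x] = (rinner (poly_op p T x) x)%:C.
Proof.
move=> hT; rewrite /Re_op ipZl ipDl [X in _ + X]ipC.
rewrite -(adjointP (poly_op_linear p T) (fun y => poly_op_bounded p y hT)).
by rewrite /rinner ReJ_add mulrC.
Qed.

Lemma le_Re_opP (p : {poly R[i]}) T T' (c : R) : contractive T -> contractive T' ->
  le_op (Re_op (poly_op p T)) (fun x => c%:C *: Re_op (poly_op p T') x) <->
  forall x, rinner (poly_op p T x) x <= c * rinner (poly_op p T' x) x.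
Proof.
move=> hT hT'.
have E x : '[c%:C *: Re_op (poly_op p T') x - Re_op (poly_op p T) x, x] =
    (c * rinner (poly_op p T' x) x - rinner (poly_op p T x) x)%:C.
  by rewrite ipBl ipZl !Re_op_poly// rmorphB rmorphM.
by split=> h x; have := h x; rewrite /= E ler0c subr_ge0.
Qed.

Lemma cmod_conjc z : cmod (conjc z) = cmod z.
Proof. by rewrite /cmod !normc_def; case: z => a b /=; rewrite sqrrN. Qed.

Definition fejer_le T T' (c : R) := forall M z x, cmod z = 1 ->
  fejer T M z x <= c * fejer T' M z x.

Definition toeplitz_le T T' (c : R) := forall (h : nat -> H) N,
  (forall k, (N <= k)%N -> h k = 0) -> toeplitz T h N <= c * toeplitz T' h N.

Lemma harnack_fejer T T' (c : R) : contractive T -> contractive T' ->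
  (forall p : {poly R[i]}, (forall z, `|z| <= 1 -> 0 <= complex.Re p.[z]) ->
    le_op (Re_op (poly_op p T)) (fun x => c%:C *: Re_op (poly_op p T') x)) ->
  fejer_le T T' c.
Proof.
move=> hT hT' hc M z x z1.
pose p := \poly_(k < M) (fejer_weight R M k * z ^+ k).
have pM : (size p <= M)%N by exact: size_poly.
have pos u : `|u| <= 1 -> 0 <= complex.Re p.[u].
  move=> u1; rewrite horner_poly.
  rewrite (eq_bigr (fun k : 'I_M => fejer_weight R M k * (z * u) ^+ k)); last first.
    by move=> k _; rewrite exprMn mulrA.
  apply: le_trans (fejer_kernel_ge _ _); first exact: sqr_ge0.
  by rewrite cmodM z1 mul1r -lecR -cmodE.
have rinner_p S : rinner (poly_op p S x) x = fejer S M z x.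
  rewrite /rinner (poly_opE S x pM) ip_suml; congr complex.Re; apply: eq_bigr => k _.
  by rewrite coef_poly ltn_ord ipZl mulrA.
by have := (le_Re_opP p c hT hT').1 (hc p pos) x; rewrite !rinner_p.
Qed.

(** This is where positivity for scalar polynomials becomes positivity for
    families of vectors. *)
Lemma fejer_toeplitz_le T T' (c : R) : fejer_le T T' c -> toeplitz_le T T' c.
Proof.
move=> hE h N h0.
have [d hd] := fejer_average T h0; have [d' hd'] := fejer_average T' h0.
apply: (@le_of_linear_growth _ _ (d - c * d') N) => M NM.
have [z [z1 _ zo]] := root_of_unity_orthogonal R (ltn0Sn (N + M)).
have P0 : 0 < (N + M).+1%:R :> R by rewrite ltr0n.
have := hd _ _ z NM (ltnSn _) z1 zo; have := hd' _ _ z NM (ltnSn _) z1 zo.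
move=> e' e; suff : (N + M).+1%:R * (M%:R * toeplitz T h N - d) <=
    c * ((N + M).+1%:R * (M%:R * toeplitz T' h N - d')).
  by rewrite mulrCA ler_pM2l//; lra.
rewrite -e -e' mulr_sumr ler_sum// => j _; apply: hE.
by rewrite cmod_conjc cmodX z1 expr1n.
Qed.

Lemma toeplitz_fejer_le T T' (c : R) : toeplitz_le T T' c -> fejer_le T T' c.
Proof.
move=> hQ M z x z1; rewrite !fejer_toeplitz//; apply: hQ => k Mk.
by rewrite ltnNge Mk.
Qed.

Lemma fejer_harnack T T' (c : R) : contractive T -> contractive T' ->
  fejer_le T T' c ->
  forall p : {poly R[i]}, (forall z, `|z| <= 1 -> 0 <= complex.Re p.[z]) ->
    le_op (Re_op (poly_op p T)) (fun x => c%:C *: Re_op (poly_op p T') x).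
Proof.
move=> hT hT' hE p p_pos; apply/le_Re_opP => // x.
have [d hd] := fejer_poly_average p T x; have [d' hd'] := fejer_poly_average p T' x.
apply: (@le_of_linear_growth _ _ (d - c * d') (size p)) => M pM.
have [z [z1 _ zo]] := root_of_unity_orthogonal R (ltn0Sn (M + M)).
have P0 : 0 < (M + M).+1%:R :> R by rewrite ltr0n.
have := hd _ _ z pM (ltnSn _) zo; have := hd' _ _ z pM (ltnSn _) zo.
move=> e' e; suff : (M + M).+1%:R * (M%:R * rinner (poly_op p T x) x - d) <=
    c * ((M + M).+1%:R * (M%:R * rinner (poly_op p T' x) x - d')).
  by rewrite mulrCA ler_pM2l//; lra.
rewrite -e -e' mulr_sumr ler_sum// => j _; rewrite mulrCA ler_wpM2l ?hE//.
  by apply: p_pos; rewrite cmodE cmodX z1 expr1n.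
by rewrite cmod_conjc cmodX z1 expr1n.
Qed.

End Harnack.

(** * The resolvent bound under Harnack domination *)

Lemma small_pow (R : realType) (r e : R) : 0 <= r < 1 -> 0 < e -> exists n, r ^+ n <= e.
Proof.
move=> /andP[r0 r1] e0.
have /cvgrPdist_le/(_ _ e0)[N _ hN] : (r ^+ n @[n --> \oo] --> (0 : R))%classic.
  by apply: cvg_expr; rewrite ger0_norm.
by exists N; have := hN N (leqnn N); rewrite /= sub0r normrN ger0_norm// exprn_ge0.
Qed.

Section Transfer.
Variables (R : realType) (H : hilbertType R).
Variables T T' : {linear H -> H}.
Hypotheses (hT : contractive T) (hT' : contractive T').
Implicit Types (x y : H) (z : R[i]).

Definition defect_sq x : R := sqnorm x - sqnorm (T' x).

Lemma defect_sq_ge0 x : 0 <= defect_sq x.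
Proof. by rewrite subr_ge0 sqnorm_contractive. Qed.

Lemma tails_of_differences (g : nat -> H) N : (forall m, (N <= m)%N -> g m = 0) ->
  tails T' (fun m => g m - T' (g m.+1)) N =1 g.
Proof.
move=> g0 m; have h0 k : (N <= k)%N -> g k - T' (g k.+1) = 0.
  by move=> Nk; rewrite (g0 k)// (g0 k.+1) ?leqW// linear0 subrr.
have [Nm|/ltnW mN] := leqP N m; first by rewrite (tails_ge _ h0)// g0.
rewrite -(subKn mN); elim: (N - m)%N (leq_subr m N) => [|i IH] iN.
  by rewrite subn0 (tails_ge _ h0)// g0.
rewrite (tails_rec _ _ h0) -subSn// subSS IH ?subrK//.
exact: ltnW.
Qed.

(** [g_0] and [sum_k T^k h_k] differ because [T'] was used to produce [h] from
    [g]; the correction telescopes. *)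
Lemma tails_transfer (g h : nat -> H) N : (forall m, h m = g m - T' (g m.+1)) -> g N = 0 ->
  tails T h N 0 = g 0%N + \sum_(k < N) iter k T (T (g k.+1) - T' (g k.+1)).
Proof.
move=> hg gN.
suff E n : \sum_(k < n) iter k T (h k) =
    g 0%N - iter n T (g n) + \sum_(k < n) iter k T (T (g k.+1) - T' (g k.+1)).
  by rewrite /tails E gN linear0 subr0.
elim: n => [|n IH]; first by rewrite !big_ord0 addr0 subrr.
rewrite !big_ord_recr /= IH hg !linearB /= -iterS iterSr.
have aux (p a b c S : H) : p - a + S + (a - c) = p - b + (S + (b - c)).
  by rewrite addrAC (addrA (p - a)) subrK [in RHS]addrCA (addrA (p - b)) subrK addrC.
exact: aux.
Qed.

(** The family below is [h_0 = - T' x], [h_(k+1) = z^k (x - z T' x)], cut off at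
    [n] and described through its tails [g = 0, x, z x, z^2 x, ...].  Its tail
    for [T] is the [n]-th partial sum of the Neumann series of [y]. *)
Lemma resolvent_bound (c : R) x y z : toeplitz_le T T' c -> 0 <= c -> cmod z < 1 ->
  y - z *: T y = T x - T' x -> sqnorm y <= c / (1 - cmod z ^+ 2) * defect_sq x.
Proof.
move=> hQ c0 z1 hy; set r := cmod z in z1 *.
have r0 : 0 <= r := cmod_ge0 z.
have r2 : 0 < 1 - r ^+ 2 by rewrite subr_gt0 expr_lt1.
set B := c / _ * _.
pose u n := \sum_(k < n) z ^+ k *: iter k T (T x - T' x).
have u_le n : sqnorm (u n) <= B.
  pose g k := if k is k'.+1 then if (k' < n)%N then z ^+ k' *: x else 0 else 0.
  pose h m := g m - T' (g m.+1).
  have g0 m : (n.+1 <= m)%N -> g m = 0 by case: m => //= m; rewrite ltnS leqNgt => /negbTE ->.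
  have h0 m : (n.+1 <= m)%N -> h m = 0.
    by move=> nm; rewrite /h (g0 m)// (g0 m.+1) ?leqW// linear0 subrr.
  have Tg k : T (g k.+1) - T' (g k.+1) = if (k < n)%N then z ^+ k *: (T x - T' x) else 0.
    rewrite /=; case: ifP => _; first by rewrite [T _]linearZ [T' _]linearZ -scalerBr.
    by rewrite [T 0]linear0 [T' 0]linear0 subrr.
  have g00 : g 0%N = 0 by [].
  have gS k : g k.+1 = if (k < n)%N then z ^+ k *: x else 0 by [].
  clearbody g; have := hQ h n.+1 h0; rewrite !toeplitz_tails//.
  have eg m : tails T' h n.+1 m = g m by exact: tails_of_differences.
  have -> : tails T h n.+1 0 = u n.
    rewrite (@tails_transfer g h n.+1 (fun m => erefl) (g0 _ (leqnn _))).
    rewrite g00 add0r big_ord_recr /= Tg ltnn linear0 addr0.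
    by apply: eq_bigr => k _; rewrite Tg ltn_ord linearZ.
  have -> : sqnorm (tails T' h n.+1 0) = 0 by rewrite eg g00 /sqnorm /rinner ip0l.
  rewrite add0r.
  have -> : \sum_(m < n.+1)
      (sqnorm (tails T' h n.+1 m.+1) - sqnorm (T' (tails T' h n.+1 m.+1))) =
     (\sum_(k < n) (r ^+ 2) ^+ k) * defect_sq x.
    rewrite big_ord_recr /= !eg g0// linear0 subrr addr0 mulr_suml.
    apply: eq_bigr => k _; rewrite eg gS ltn_ord [T' _]linearZ !sqnormZ cmodX exprAC.
    by rewrite -mulrBr.
  set S1 := \sum_(m < n.+1) _ => hle.
  have S10 : 0 <= S1 by apply: sumr_ge0 => m _; rewrite subr_ge0 sqnorm_contractive.
  apply: le_trans (_ : c * ((\sum_(k < n) (r ^+ 2) ^+ k) * defect_sq x) <= _); first lra.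
  rewrite /B -mulrA ler_wpM2l// ler_wpM2r ?defect_sq_ge0//.
  rewrite -[leRHS]mul1r ler_pdivlMr// mulrC.
  have -> : (1 - r ^+ 2) * (\sum_(k < n) (r ^+ 2) ^+ k) = 1 - (r ^+ 2) ^+ n.
    by have := subrX1 (r ^+ 2) n => e; rewrite -[1 - r ^+ 2]opprB mulNr -e opprB.
  by rewrite gerBl !exprn_ge0.
have yE n : y = u n + z ^+ n *: iter n T y.
  elim: n => [|n IH]; first by rewrite /u big_ord0 add0r scale1r.
  rewrite {1}IH /u big_ord_recr /= -addrA; congr (_ + _).
  have {1}-> : y = (T x - T' x) + z *: T y by rewrite -hy subrK.
  rewrite linearD /= [iter n T (_ *: _)]linearZ scalerDr scalerA -exprSr.
  by congr (_ + _ *: _); rewrite -iterS iterSr.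
apply/ler_addgt0Pr => e e0.
have y1 : 0 < 2 * sqnorm y + 1 by have := sqnorm_ge0 y; lra.
have [||n hn] := @small_pow R r (e / (2 * sqnorm y + 1)); first by rewrite r0.
  by rewrite divr_gt0.
rewrite ler_pdivlMr// in hn.
have : rnorm y <= rnorm (u n) + r ^+ n * rnorm y.
  rewrite {1}(yE n) (le_trans (rnormD _ _))// lerD// rnormZ cmodX.
  by rewrite ler_wpM2l ?exprn_ge0// iter_contractive.
have e1 : 0 <= r ^+ n <= 1 by rewrite exprn_ge0//= exprn_ile1// ltW.
have := u_le n; have := rnorm_ge0 (u n); have := rnorm_ge0 y.
move: hn e1; rewrite !sqnormE; set E := r ^+ n; set a := rnorm y; set b := rnorm (u n).
move=> hn /andP[E0 E1] a0 b0 hb hab.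
have : (a - E * a) ^+ 2 <= b ^+ 2 by rewrite ler_pXn2r ?nnegrE//; nra.
nra.
Qed.

End Transfer.

(** * Carleson embedding for isometries *)

Section Carleson.
Variables (R : realType) (H : hilbertType R).
Variables T T' : {linear H -> H}.
Hypotheses (hT : contractive T) (hT' : contractive T').
Hypothesis (isoT : isometric T).
Variable c : R.
Hypothesis c0 : 0 <= c.
Hypothesis resolvent_le : forall x y (z : R[i]), cmod z < 1 ->
  y - z *: T y = T x - T' x -> (1 - cmod z ^+ 2) * sqnorm y <= c * defect_sq T' x.
Implicit Types (x y : H) (z : R[i]).

Let X : {linear H -> H} := T \- T'.

Lemma sqnorm_isometric x : sqnorm (T x) = sqnorm x.
Proof. by rewrite !sqnormE /rnorm isoT. Qed.

Section Radius.
Variables (r : R) (h : nat -> H) (N : nat).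
Hypotheses (r0 : 0 <= r) (r1 : r < 1).
Hypothesis h0 : forall k, (N <= k)%N -> h k = 0.

(** Solving the resolvent equation at the points [r w], for [w] in a group of
    [P = N + K] roots of unity, and taking discrete Fourier coefficients turns
    it into a cyclic recursion. *)
Lemma cyclic_resolvent K : exists Y : nat -> H,
  [/\ forall n, (n < N + K)%N -> Y n = r%:C *: T (Y n.+1) + X (h n),
      Y (N + K)%N = Y 0%N &
      (1 - r ^+ 2) * \sum_(n < N + K) sqnorm (Y n) <= c * \sum_(k < N) defect_sq T' (h k)].
Proof.
have [P0|P0] := posnP (N + K).
  exists (fun _ => 0); rewrite P0 big_ord0 mulr0; split=> //.
  by rewrite mulr_ge0// sumr_ge0// => k _; rewrite defect_sq_ge0.
set P := (N + K)%N in P0 *.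
have [z [z1 zP zo]] := root_of_unity_orthogonal R P0.
have PR : 0 < P%:R :> R by rewrite ltr0n.
have PC : P%:R != 0 :> R[i] by rewrite pnatr_eq0 -lt0n.
pose w j := z ^+ j.
have w1 j : cmod (w j) = 1 by rewrite cmodX z1 expr1n.
pose f j := \sum_(n < P) (conjc z ^+ j) ^+ n *: h n.
have /choice[y hy] : forall j : nat, exists y, y - (r%:C * w j) *: T y = X (f j).
  by move=> j; apply: resolvent_solvable => //; rewrite cmodM w1 mulr1 cmod_real.
pose Y n := P%:R^-1 *: \sum_(j < P) w j ^+ n *: y j.
exists Y; split.
- move=> n nP.
  have fc : \sum_(j < P) w j ^+ n *: f j = P%:R *: h n.
    rewrite /f; under eq_bigr do rewrite scaler_sumr.
    rewrite exchange_big (bigD1 (Ordinal nP)) //= [X in _ + X]big1 ?addr0 => [|m mn].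
      under eq_bigr do rewrite scalerA.
      rewrite -scaler_suml; congr (_ *: _).
      transitivity (if n == n then P%:R else 0 : R[i]); last by rewrite eqxx.
      by rewrite -zo//; apply: eq_bigr => j _; rewrite !rmorphXn.
    under eq_bigr do rewrite scalerA.
    rewrite -scaler_suml (_ : \sum_(i < P) _ = 0) ?scale0r//.
    transitivity (if n == m then P%:R else 0 : R[i]).
      by rewrite -zo//; apply: eq_bigr => j _; rewrite !rmorphXn.
    by rewrite ifF//; apply/negbTE; apply: contra mn => /eqP e; apply/eqP/val_inj.
  have yE j : y j = X (f j) + (r%:C * w j) *: T (y j) by rewrite -hy subrK.
  have e1 : \sum_(j < P) w j ^+ n *: y j =
      X (\sum_(j < P) w j ^+ n *: f j) + r%:C *: T (\sum_(j < P) w j ^+ n.+1 *: y j).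
    rewrite [X _]linear_sum [T _]linear_sum scaler_sumr -big_split /=.
    apply: eq_bigr => j _; rewrite {1}yE scalerDr; congr (_ + _).
      by rewrite [T (_ *: _)]linearZ [T' (_ *: _)]linearZ -scalerBr.
    by rewrite [T (_ *: _)]linearZ !scalerA exprS; congr (_ *: _); ring.
  rewrite /Y e1 fc scalerDr [X _]linearZ scalerA mulVf// scale1r addrC.
  by congr (_ + _); rewrite [T (_ *: _)]linearZ !scalerA mulrC.
- rewrite /Y; congr (_ *: _); apply: eq_bigr => j _.
  by rewrite /w exprAC zP expr1n expr0.
have -> : \sum_(n < P) sqnorm (Y n) = P%:R^-1 * \sum_(j < P) sqnorm (y j).
  have := parseval y zo; rewrite /Y => e.
  under eq_bigr do rewrite sqnormZ.
  rewrite -mulr_sumr (_ : cmod _ = P%:R^-1); last first.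
    by rewrite -(rmorph_nat (real_complex R)) -fmorphV cmod_real// invr_ge0 ltW.
  rewrite -[in RHS](mulKf (lt0r_neq0 PR) (\sum_(j < P) sqnorm (y j))) -e mulrA -expr2.
  by congr (_ * _); apply: eq_bigr => n _; congr sqnorm; apply: eq_bigr => j _; rewrite exprAC.
have q_avg : \sum_(j < P) defect_sq T' (f j) = P%:R * \sum_(k < N) defect_sq T' (h k).
  rewrite /defect_sq !sumrB mulrBr.
  have trunc (F : nat -> H) : (forall k, (N <= k)%N -> F k = 0) ->
      \sum_(k < N) sqnorm (F k) = \sum_(k < P) sqnorm (F k).
    move=> F0; rewrite (big_ord_widen P (fun k => sqnorm (F k)) (leq_addr _ _)) big_mkcond /=.
    apply: eq_bigr => k _; case: ltnP => // Nk.
    by rewrite F0// /sqnorm /rinner ip0l.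
  rewrite (trunc h)// (trunc (fun k => T' (h k))); last first.
    by move=> k Nk; rewrite h0// linear0.
  have zo' := discrete_orthogonal_conj zo.
  rewrite -(parseval h zo') -(parseval (fun k => T' (h k)) zo'); congr (_ - _).
  apply: eq_bigr => j _; rewrite /f linear_sum; congr sqnorm; apply: eq_bigr => n _.
  by rewrite [T' _]linearZ.
rewrite mulrCA ler_pdivrMl// mulrCA -q_avg !mulr_sumr ler_sum// => j _.
have := @resolvent_le (f j) (y j) (r%:C * w j).
by rewrite cmodM w1 mulr1 cmod_real//; apply => //; exact: hy.
Qed.

(** In [cyclic_resolvent] the vectors [Y_(N+K) = Y_0, ..., Y_N], in this order,
    are successive images of [Y_0] under [r T] with [T] isometric, so their
    squared norms add up to [|Y_0|^2] times a geometric sum of ratio [r^2], while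
    [Y_0] differs from the sum to be bounded by [r^(N+K) T^(N+K) Y_0].  Let [K -> oo]. *)
Lemma carleson_radius :
  r ^+ 2 * sqnorm (\sum_(k < N) r%:C ^+ k *: iter k T (X (h k))) <=
  c * \sum_(k < N) defect_sq T' (h k).
Proof.
set S := \sum_(k < N) _; set C := c * _; set s := r ^+ 2.
have s0 : 0 <= s by exact: sqr_ge0.
have C0 : 0 <= C by rewrite mulr_ge0// sumr_ge0// => k _; rewrite defect_sq_ge0.
have approx K : s * (1 - r ^+ K) * sqnorm S <= (1 + r ^+ K) * C.
  have [Y [Yrec Ycyc Ysum]] := cyclic_resolvent K.
  have unroll n : (n <= N)%N ->
      Y 0%N = \sum_(k < n) r%:C ^+ k *: iter k T (X (h k)) + r%:C ^+ n *: iter n T (Y n).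
    elim: n => [|n IH] nN; first by rewrite big_ord0 add0r scale1r.
    rewrite (IH (ltnW nN)) big_ord_recr /= -addrA; congr (_ + _).
    rewrite (Yrec n); last by rewrite (leq_trans nN)// leq_addr.
    rewrite linearD /= scalerDr addrC; congr (_ + _).
    by rewrite [iter n T (_ *: _)]linearZ scalerA -exprSr -iterS iterSr.
  have back i : (i <= K)%N -> sqnorm (Y (N + K - i)%N) = s ^+ i * sqnorm (Y 0%N).
    elim: i => [|i IH] iK; first by rewrite subn0 Ycyc mul1r.
    rewrite Yrec; last by lia.
    have -> : ((N + K - i.+1).+1 = N + K - i)%N by lia.
    rewrite h0 ?linear0 ?addr0; last by lia.
    by rewrite sqnormZ sqnorm_isometric IH ?(ltnW iK)// cmod_real// -/s exprS mulrA.
  have Ylow : (\sum_(i < K) s ^+ i.+1) * sqnorm (Y 0%N) <= \sum_(n < N + K) sqnorm (Y n).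
    rewrite big_split_ord /= (reindex_inj rev_ord_inj) /= [leRHS]addrC ler_wpDr//.
      by apply: sumr_ge0 => n _; exact: sqnorm_ge0.
    rewrite mulr_suml ler_sum// => i _; have iK := ltn_ord i.
    rewrite -back//; last by lia.
    by rewrite le_eqVlt; apply/orP; left; apply/eqP; congr (sqnorm (Y _)); lia.
  have geom : (1 - s) * (\sum_(i < K) s ^+ i.+1) = s * (1 - s ^+ K).
    under eq_bigr do rewrite exprS.
    rewrite -mulr_sumr mulrCA; congr (_ * _).
    by have := subrX1 s K => e; rewrite -[1 - s]opprB mulNr -e opprB.
  have s1 : 0 <= 1 - s by rewrite subr_ge0 exprn_ile1// ltW.
  have hY0 : s * (1 - s ^+ K) * sqnorm (Y 0%N) <= C.
    rewrite -geom -mulrA; apply: le_trans (Ysum).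
    by rewrite ler_wpM2l.
  set e := r ^+ K; have e0 : 0 <= e by exact: exprn_ge0.
  have e1 : e <= 1 by rewrite exprn_ile1// ltW.
  have sK : s ^+ K = e ^+ 2 by rewrite /s /e exprAC.
  have hN : rnorm (Y N) = e * rnorm (Y 0%N).
    have := back K (leqnn K); rewrite addnK sK !sqnormE -exprMn => /eqP.
    by rewrite eqrXn2// ?mulr_ge0 ?rnorm_ge0// => /eqP.
  have hS : rnorm S <= (1 + e) * rnorm (Y 0%N).
    have -> : S = Y 0%N - r%:C ^+ N *: iter N T (Y N) by rewrite (unroll N)// addrK.
    rewrite (le_trans (rnormD _ _))// rnormN mulrDl mul1r lerD2l rnormZ -hN.
    rewrite cmodX cmod_real//.
    have := iter_contractive N (Y N) hT; have := rnorm_ge0 (Y N).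
    have := rnorm_ge0 (iter N T (Y N)).
    have : r ^+ N <= 1 by rewrite exprn_ile1// ltW.
    have : 0 <= r ^+ N by rewrite exprn_ge0.
    nra.
  have : sqnorm S <= (1 + e) ^+ 2 * sqnorm (Y 0%N).
    rewrite !sqnormE -exprMn ler_pXn2r ?nnegrE ?rnorm_ge0// mulr_ge0 ?rnorm_ge0// addr_ge0//.
  move=> hS2; apply: le_trans (_ : s * (1 - e) * ((1 + e) ^+ 2 * sqnorm (Y 0%N)) <= _).
    by rewrite ler_wpM2l// mulr_ge0// subr_ge0.
  have -> : s * (1 - e) * ((1 + e) ^+ 2 * sqnorm (Y 0%N)) =
      (1 + e) * (s * (1 - e ^+ 2) * sqnorm (Y 0%N)) by ring.
  by rewrite ler_wpM2l ?addr_ge0// -sK.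
apply/ler_addgt0Pr => e e0.
have D0 : 0 < C + s * sqnorm S + 1 by rewrite ltr_wpDl// addr_ge0// mulr_ge0// sqnorm_ge0.
have [||K hK] := @small_pow R r (e / (C + s * sqnorm S + 1)); first by rewrite r0.
  by rewrite divr_gt0.
rewrite ler_pdivlMr// in hK; have := approx K; have := exprn_ge0 K r0.
move: (r ^+ K) hK => E; nra.
Qed.

End Radius.

Lemma bernoulli (d : R) m : 0 <= d <= 1 -> 1 - m%:R * d <= (1 - d) ^+ m.
Proof.
move=> /andP[d0 d1]; elim: m => [|m IH]; first by rewrite mul0r subr0.
rewrite exprS -natr1; have : 0 <= m%:R :> R by [].
by move: (m%:R) ((1 - d) ^+ m) IH => a b; nra.
Qed.

(** Apply [carleson_radius] to [r^(-k) h_k] and let [r -> 1]. *)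
Lemma carleson (h : nat -> H) N : (forall k, (N <= k)%N -> h k = 0) ->
  sqnorm (\sum_(k < N) iter k T (T (h k) - T' (h k))) <=
  c * \sum_(k < N) defect_sq T' (h k).
Proof.
move=> h0; set A := sqnorm _; set C := c * _.
have A0 : 0 <= A by exact: sqnorm_ge0.
have scaled r : 0 < r < 1 -> r ^+ (N.*2).+2 * A <= C.
  move=> /andP[r0 r1].
  have rC : r%:C != 0 :> R[i] by rewrite (inj_eq (@complexI R)) gt_eqF.
  have h0' k : (N <= k)%N -> (r%:C ^- k *: h k) = 0 by move=> Nk; rewrite h0// scaler0.
  have := carleson_radius (ltW r0) r1 h0'.
  rewrite (_ : sqnorm _ = A); last first.
    congr sqnorm; apply: eq_bigr => k _.
    by rewrite [X _]linearZ [iter k T _]linearZ scalerA divff ?scale1r// expf_neq0.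
  move=> hle.
  rewrite -addn2 exprD -mulrA mulrC -ler_pdivlMr ?exprn_gt0//.
  apply: le_trans hle _; rewrite /C -mulrA ler_wpM2l// mulr_suml ler_sum// => k _.
  rewrite /defect_sq [T' _]linearZ !sqnormZ -mulrBr mulrC ler_wpM2l ?defect_sq_ge0//.
  have -> : cmod (r%:C ^- k) = r ^- k.
    by rewrite -rmorphXn -fmorphV cmod_real// invr_ge0 exprn_ge0// ltW.
  rewrite exprVn -exprM muln2 lef_pV2 ?posrE ?exprn_gt0// ler_wiXn2l ?(ltW r0) ?(ltW r1)//.
  by rewrite leq_double ltnW.
(* With [r = 1 - d], Bernoulli gives [(1 - m d) A <= C]; this [d] makes the
   error [m d A] at most [e]. *)
apply/ler_addgt0Pr => e e0.
set m := (N.*2).+2 in scaled.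
have mA : 0 < m%:R * A + 1 by rewrite ltr_wpDl// mulr_ge0.
pose d := Num.min 2^-1 (e / (m%:R * A + 1)).
have d1 : d <= 2^-1 by rewrite ge_min lexx.
have d2 : d <= e / (m%:R * A + 1) by rewrite ge_min lexx orbT.
have d0 : 0 < d by rewrite lt_min invr_gt0 ltr0n divr_gt0.
have d01 : 0 < 1 - d < 1 by apply/andP; split; lra.
have d01' : 0 <= d <= 1 by apply/andP; split; lra.
have := scaled _ d01; have := bernoulli m d01'; rewrite ler_pdivlMr// in d2.
move: ((1 - d) ^+ m) (m%:R) d2 => p q; nra.
Qed.

End Carleson.

(** * Harnack domination of contractions and of isometries *)

Theorem theorem2p7 (R : realType) (H : hilbertType R) (T T' : {linear H -> H})
    (hT : contractive T) (hT' : contractive T') :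
  (harnack_dominated T T' ->
    exists c : R, 0 < c /\
      forall (h : H) (lambda : R[i]), `|lambda| < 1 ->
        `|inv_op (fun x : H => x - lambda *: T x) (T h - T' h)| ^+ 2 <=
          c%:C / (1 - `|lambda| ^+ 2) * `|defect T' h| ^+ 2)
  /\
  (isometric T ->
    (exists c : R, 0 < c /\
      forall (h : H) (lambda : R[i]), `|lambda| < 1 ->
        `|inv_op (fun x : H => x - lambda *: T x) (T h - T' h)| ^+ 2 <=
          c%:C / (1 - `|lambda| ^+ 2) * `|defect T' h| ^+ 2) ->
    harnack_dominated T T').
Proof.
have real_form (c : R) (y h : H) (lambda : R[i]) :
    (`|y| ^+ 2 <= c%:C / (1 - `|lambda| ^+ 2) * `|defect T' h| ^+ 2) =
    (sqnorm y <= c / (1 - cmod lambda ^+ 2) * defect_sq T' h).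
  rewrite !rnormE cmodE -!rmorphXn -[1]/(1%:C) -rmorphB -fmorphV -!rmorphM lecR.
  by rewrite -!sqnormE sqnorm_defect.
have lt1 (lambda : R[i]) : (`|lambda| < 1) = (cmod lambda < 1).
  by rewrite cmodE -[1]/(1%:C) ltcR.
split=> [[c [c1 hc]]|isoT [c [c0 hc]]].
  have c0 : 0 < c by apply: lt_le_trans c1.
  exists c; split=> // h lambda; rewrite lt1 real_form => l1.
  have hQ := fejer_toeplitz_le (harnack_fejer hT hT' hc).
  exact: (resolvent_bound hT hT' hQ (ltW c0) l1 (inv_op_resolvent hT _ l1)).
(* [|g_0 + D|^2 <= 2 |g_0|^2 + 2 |D|^2] and [|D|^2 <= c sum_m |D_T' g_m|^2]. *)
exists (2 * (1 + c)); split; first by lra.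
apply: fejer_harnack => //; apply: toeplitz_fejer_le => h N h0.
pose g := tails T' h N.
have gN m : (N <= m)%N -> g m = 0 by move=> Nm; exact: (tails_ge T' h0 Nm).
rewrite !toeplitz_tails// [X in _ + X <= _]big1 ?addr0 => [|m _]; last first.
  by rewrite (sqnorm_isometric isoT) subrr.
have hg m : h m = g m - T' (g m.+1) by rewrite /g (tails_rec _ _ h0) addrK.
rewrite (tails_transfer T hg (gN _ (leqnn N))).
rewrite -/(g 0%N); set D := \sum_(k < N) iter k T _.
have hD : sqnorm D <= c * \sum_(m < N) defect_sq T' (g m.+1).
  apply: (@carleson _ _ T T' hT hT' isoT c (ltW c0) _ (fun k => g k.+1)) => [x y z z1 hy|k Nk].
    have -> : y = inv_op (fun x => x - z *: T x) (T x - T' x).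
      by apply: (resolvent_inj hT z1); rewrite inv_op_resolvent.
    have := hc x z; rewrite lt1 real_form => /(_ z1).
    by rewrite mulrAC ler_pdivlMr ?subr_gt0 ?expr_lt1 ?cmod_ge0// [_ * sqnorm _]mulrC.
  by rewrite gN// leqW.
rewrite -/(defect_sq T' _) -/g.
have -> : \sum_(m < N) (sqnorm (tails T' h N m.+1) - sqnorm (T' (tails T' h N m.+1))) =
  \sum_(m < N) defect_sq T' (g m.+1) by [].
have S0 : 0 <= \sum_(m < N) defect_sq T' (g m.+1).
  by apply: sumr_ge0 => m _; exact: defect_sq_ge0.
have := sqnorm_ge0 (g 0%N - D); have := sqnorm_ge0 (g 0%N); rewrite sqnormB sqnormD.
move: hD S0; rewrite -/(g 0%N); move: (\sum_(m < N) _) => S; nra.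
Qed.
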